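(* The groups $G(\alpha)$ and $G(\widetilde{\alpha})$ are isomorphic if and only if $\widetilde{\alpha} = \mathrm{ad}(h) \circ \beta \alpha \beta^{-1}$ for some group isomorphism $\beta: \Gamma \to \widetilde{\Gamma}$ and some $h \in \widetilde{\Gamma}$, where $\mathrm{ad}(h)$ denotes conjugation by $h$.
   Context: Let $\Gamma$ and $\widetilde{\Gamma}$ be groups, and let $\alpha \in \mathrm{Aut}(\Gamma)$ and $\widetilde{\alpha} \in \mathrm{Aut}(\widetilde{\Gamma})$ be automorphisms. Let $V$ be Richard Thompson's group $V$, acting on the Cantor space $\mathfrak{C} = \{0,1\}^{\mathbb{N}}$, and let $\mathbb{Q}_2 \subset \mathfrak{C}$ be the dyadic rationals, i.e. the infinite binary sequences that are eventually $0$. For $v \in V$ and $x \in \mathbb{Q}_2$, $v'(x)$ denotes the slope of $v$ at $x$ (a power of $2$). Define $G(\alpha) := K(\alpha) \rtimes V$, where $K(\alpha)$ is the group of maps $a: \{0,1\}^* \to \Gamma$ satisfying $a(u) = \alpha(a(u0))$ for all words $u \in \{0,1\}^*$, with $V$ acting by the Jones action associated to the group morphism $\Gamma^2 \to \Gamma, (g,h) \mapsto \alpha(g)$. Equivalently, $G(\alpha)$ is isomorphic to the unrestricted twisted permutational wreath product $\prod_{\mathbb{Q}_2} \Gamma \rtimes_\rho V$, where $\rho(v)(a)(x) = \alpha^{-\log_2(v'(v^{-1}x))}(a(v^{-1}x))$ for $a: \mathbb{Q}_2 \to \Gamma$, $v \in V$, $x \in \mathbb{Q}_2$. Define $G(\widetilde{\alpha})$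 analogously from $\widetilde{\Gamma}$ and $\widetilde{\alpha}$. *)

(* Defs.v *)
(* Abstract (possibly infinite) groups as explicit records;
   Thompson's group V as homeomorphisms of Cantor space given by finite
   prefix-replacement data; G(alpha) = prod_{Q_2} Gamma  x|_rho  V. *)
From Stdlib Require Import ZArith List Classical ClassicalEpsilon.
Import ListNotations.
Set Implicit Arguments.

Record group := Group {
  gcar :> Type;
  gmul : gcar -> gcar -> gcar;
  gone : gcar;
  ginv : gcar -> gcar;
  gmulA : forall x y z, gmul x (gmul y z) = gmul (gmul x y) z;
  gmul1l : forall x, gmul gone x = x;
  gmulVl : forall x, gmul (ginv x) x = gone
}.
Arguments gmul {g} _ _.
Arguments gone {g}.
Arguments ginv {g} _.

Definition is_hom (G H : group) (f : G -> H) : Prop :=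
  forall x y, f (gmul x y) = gmul (f x) (f y).

Record giso (G H : group) := GIso {
  iso_fun :> G -> H;
  iso_inv : H -> G;
  iso_hom : @is_hom G H iso_fun;
  iso_invK : forall x, iso_inv (iso_fun x) = x;
  iso_funK : forall y, iso_fun (iso_inv y) = y
}.

Definition aut (G : group) := giso G G.

Definition aut_pow (G : group) (a : aut G) (k : Z) : G -> G :=
  match k with
  | Z0 => fun x => x
  | Zpos p => Nat.iter (Pos.to_nat p) (iso_fun a)
  | Zneg p => Nat.iter (Pos.to_nat p) (iso_inv a)
  end.

Definition ad {G : group} (h : G) (x : G) : G := gmul (gmul h x) (ginv h).

Definition cantor := nat -> bool.

Definition app_word (u : list bool) (z : cantor) : cantor :=
  fun n => if Nat.ltb n (length u) then nth n u false else z (n - length u).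

Definition is_prefix (u : list bool) (x : cantor) : Prop :=
  forall i, i < length u -> nth i u false = x i.

Definition is_partition (P : list (list bool)) : Prop :=
  forall x : cantor, exists! i, i < length P /\ is_prefix (nth i P []) x.

Definition isV (f : cantor -> cantor) : Prop :=
  exists P Q : list (list bool),
    length P = length Q /\ is_partition P /\ is_partition Q /\
    forall i z, i < length P -> f (app_word (nth i P []) z) = app_word (nth i Q []) z.

(** Dyadic rationals: sequences that are eventually 0. *)
Definition Q2 := {x : cantor | exists N, forall n, N <= n -> x n = false}.

(** v^{-1} x for x in Q2 (classical choice; for v in V it is the inverse). *)
Definition preim (f : cantor -> cantor) (x : Q2) : Q2 :=
  match excluded_middle_informative
          (exists y : Q2, f (proj1_sig y) = proj1_sig x) with
  | left H => proj1_sig (constructive_indefinite_description _ H)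
  | right _ => x
  end.

(** log_2 of the slope v'(x): |u| - |w| whenever u is a prefix of x and
    v(u z) = w z for all z (this is independent of the choice for v in V). *)
Definition logslope (f : cantor -> cantor) (x : cantor) : Z :=
  match excluded_middle_informative
          (exists k : Z, exists u w : list bool, is_prefix u x /\
             (forall z, f (app_word u z) = app_word w z) /\
             k = (Z.of_nat (length u) - Z.of_nat (length w))%Z) with
  | left H => proj1_sig (constructive_indefinite_description _ H)
  | right _ => 0%Z
  end.

Definition Gcar (Gam : group) := ((Q2 -> Gam) * (cantor -> cantor))%type.

Definition inG (Gam : group) (g : Gcar Gam) : Prop := isV (snd g).

Definition rho (Gam : group) (al : aut Gam) (v : cantor -> cantor)
    (a : Q2 -> Gam) : Q2 -> Gam :=
  fun x => aut_pow al (- logslope v (proj1_sig (preim v x)))%Z (a (preim v x)).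

Definition Gmul (Gam : group) (al : aut Gam) (g h : Gcar Gam) : Gcar Gam :=
  (fun x => gmul (fst g x) (rho al (snd g) (fst h) x),
   fun y => snd g (snd h y)).

Definition G_isomorphic (Gam Gam' : group) (al : aut Gam) (al' : aut Gam') : Prop :=
  exists phi : Gcar Gam -> Gcar Gam',
    (forall g, inG g -> inG (phi g)) /\
    (forall g h, inG g -> inG h -> phi g = phi h -> g = h) /\
    (forall k, inG k -> exists g, inG g /\ phi g = k) /\
    (forall g h, inG g -> inG h -> phi (Gmul al g h) = Gmul al' (phi g) (phi h)).

(* Main.v *)
Require Import Defs.
From Stdlib Require Import ZArith List Classical ClassicalEpsilon
  FunctionalExtensionality ProofIrrelevance Lia ssreflect.
Import ListNotations.
Set Implicit Arguments.

(* Write G(al) = K x| V with K = Gam^(Q_2), and let th : G(al) -> G(al') be an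
   isomorphism.

   th(K) = K': the image L of K in V is a normal subgroup which is the product
   of two commuting subgroups, the images of the elements of K supported on the
   cones 0 and 1, conjugate to each other in V.  As V is highly transitive on
   Q_2, L would contain an element of one factor moving a point w but fixing
   n(w) <> w for some n in the other factor, unless L = 1.

   th permutes coordinates: say that x and y correspond if th(Gam_x) has a
   nontrivial value at y.  The key fact is that an element of V which is trivial
   near x is then sent to an element fixing y ([nearid_act]).  Since every
   element of V is a transposition of two cones times an element trivial near
   some point, y determines x.  Comparing with th^-1 gives a bijection of Q_2
   which is equivariant, hence a homeomorphism, since the sets of points moved
   by elements of V form a basis of the topology.  So contracting germs
   of slope 1/2 at x go to contracting germs of slope 1/2 at y, and comparing
   their actions on Gam_x and Gam'_y gives the conjugacy up to ad(h). *)

(** * Words and the Cantor space *)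

Definition shift (n : nat) (x : cantor) : cantor := fun i => x (n + i).
Definition take (n : nat) (x : cantor) : list bool := map x (seq 0 n).

Lemma app_word_lt u z i : i < length u -> app_word u z i = nth i u false.
Proof. by move=> h; rewrite /app_word; move/Nat.ltb_lt: h => ->. Qed.

Lemma app_word_ge u z i : app_word u z (length u + i) = z i.
Proof.
rewrite /app_word; have -> : Nat.ltb (length u + i) (length u) = false.
  apply/Nat.ltb_ge; lia.
by congr z; lia.
Qed.

Lemma app_word_app u w z : app_word (u ++ w) z = app_word u (app_word w z).
Proof.
extensionality n.
case: (Nat.lt_ge_cases n (length u)) => h.
  rewrite (app_word_lt _ _ h) app_word_lt ?length_app; first lia.
  by rewrite app_nth1.
have -> : n = length u + (n - length u) by lia.
rewrite app_word_ge; set m := n - _.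
case: (Nat.lt_ge_cases m (length w)) => h'.
  rewrite (app_word_lt _ _ h') app_word_lt ?length_app; first lia.
  rewrite app_nth2; first lia.
  by congr nth; lia.
have -> : m = length w + (m - length w) by lia.
rewrite app_word_ge.
have -> : length u + (length w + (m - length w)) = length (u ++ w) + (m - length w).
  by rewrite length_app; lia.
by rewrite app_word_ge.
Qed.

Lemma shift_app_word u z : shift (length u) (app_word u z) = z.
Proof. by extensionality n; rewrite /shift app_word_ge. Qed.

Lemma app_word_injr u z z' : app_word u z = app_word u z' -> z = z'.
Proof. by move=> h; rewrite -(shift_app_word u z) h shift_app_word. Qed.

Lemma prefix_app u z : is_prefix u (app_word u z).
Proof. by move=> i h; rewrite app_word_lt. Qed.

Lemma prefix_nil x : is_prefix [] x.
Proof. by move=> i /= h; lia. Qed.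

Lemma app_shift u x : is_prefix u x -> app_word u (shift (length u) x) = x.
Proof.
move=> h; extensionality n.
case: (Nat.lt_ge_cases n (length u)) => hn.
  by rewrite app_word_lt // h.
have -> : n = length u + (n - length u) by lia.
by rewrite app_word_ge.
Qed.

Lemma length_take n x : length (take n x) = n.
Proof. by rewrite /take length_map length_seq. Qed.

Lemma nth_take n x i : i < n -> nth i (take n x) false = x i.
Proof.
move=> h; rewrite /take (nth_indep _ false (x 0)) ?length_map ?length_seq //.
by rewrite map_nth seq_nth.
Qed.

Lemma prefix_take n x : is_prefix (take n x) x.
Proof. by move=> i; rewrite length_take => h; rewrite nth_take. Qed.

Lemma take_shift n x : app_word (take n x) (shift n x) = x.
Proof. by have := app_shift (prefix_take n x); rewrite length_take. Qed.

Lemma prefix_take_iff n x z :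
  is_prefix (take n x) z <-> (forall i, i < n -> z i = x i).
Proof.
split=> h i.
  by move=> hi; rewrite -(h i) ?length_take // nth_take.
by rewrite length_take => hi; rewrite h // nth_take.
Qed.

Lemma prefix_eq_take u x : is_prefix u x -> u = take (length u) x.
Proof.
move=> h; apply: (nth_ext _ _ false false); first by rewrite length_take.
by move=> n hn; rewrite nth_take // h.
Qed.

Lemma prefix_split u w x : is_prefix u x -> is_prefix w x -> length u <= length w ->
  exists s, w = u ++ s.
Proof.
move=> hu hw hl.
exists (take (length w - length u) (shift (length u) x)).
apply: (nth_ext _ _ false false).
  by rewrite length_app length_take; lia.
move=> n hn; rewrite hw //.
case: (Nat.lt_ge_cases n (length u)) => h.
  by rewrite app_nth1 // hu.
rewrite app_nth2 // nth_take /shift; first lia.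
by congr x; lia.
Qed.

Lemma prefix_cat u s x : is_prefix (u ++ s) x -> is_prefix u x.
Proof.
move=> h i hi; rewrite -h ?length_app; first lia.
by rewrite app_nth1.
Qed.

Lemma prefix_cat_app u s z : is_prefix (u ++ s) (app_word u z) <-> is_prefix s z.
Proof.
split=> h i hi.
  have := h (length u + i); rewrite length_app app_word_ge app_nth2; first lia.
  have -> : length u + i - length u = i by lia.
  by apply; lia.
move: hi; rewrite length_app => hi.
case: (Nat.lt_ge_cases i (length u)) => hl.
  by rewrite app_nth1 // app_word_lt.
rewrite app_nth2 // h; first lia.
have {2}-> : i = length u + (i - length u) by lia.
by rewrite app_word_ge.
Qed.

Lemma app_word_inj_len u u' z z' : length u = length u' ->
  app_word u z = app_word u' z' -> u = u' /\ z = z'.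
Proof.
move=> hl he.
have h : u = u'.
  rewrite (prefix_eq_take (prefix_app u z)) he hl.
  by rewrite -(prefix_eq_take (prefix_app u' z')).
by split=> //; move: he; rewrite h => /app_word_injr.
Qed.

Definition ev0 (x : cantor) : Prop := exists N, forall n, N <= n -> x n = false.

Definition zeros : cantor := fun _ => false.

Lemma ev0_zeros : ev0 zeros.
Proof. by exists 0. Qed.

Lemma ev0_app u z : ev0 z <-> ev0 (app_word u z).
Proof.
split=> [] [N hN].
  exists (length u + N) => n hn.
  have -> : n = length u + (n - length u) by lia.
  by rewrite app_word_ge hN //; lia.
exists N => n hn; rewrite -(app_word_ge u z n) hN //; lia.
Qed.

Lemma app_word_determined_aux u w : length u < length w ->
  ~ (forall z, ev0 z -> app_word u z = app_word w z).
Proof.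
move=> hl h.
pose b := nth (length u) w false.
have h1 := h _ (proj1 (ev0_app [negb b] zeros) ev0_zeros).
have := f_equal (fun f => f (length u + 0)) h1.
rewrite app_word_ge (app_word_lt w); first lia.
rewrite (app_word_lt [_]) /=; first lia.
by rewrite Nat.add_0_r -/b; case: (b).
Qed.

(** If one word were shorter, a tail whose first digit disagrees with the next digit of the longer
    word would separate them. Testing eventually zero tails only lets the action on Q_2 decide
    equality in V. *)
Lemma app_word_determined u w :
  (forall z, ev0 z -> app_word u z = app_word w z) -> u = w.
Proof.
move=> h.
have hl : length u = length w.
  case: (Nat.lt_trichotomy (length u) (length w)) => [hl|[//|hl]].
    by case: (app_word_determined_aux hl h).
  case: (app_word_determined_aux hl) => z hz; by rewrite h.
by case: (app_word_inj_len hl (h _ ev0_zeros)).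
Qed.

(** * Thompson's group V *)

(* Acting by prefix replacement at a uniform depth makes composition and
   inversion easy, unlike the pairs of partitions in [isV]. *)
Definition local (n : nat) (f : cantor -> cantor) : Prop :=
  forall x, exists w, forall z, f (app_word (take n x) z) = app_word w z.

Definition isV' (f : cantor -> cantor) : Prop :=
  (exists g, (forall x, g (f x) = x) /\ (forall x, f (g x) = x)) /\
  exists n, local n f.

Lemma in_list_max (l : list (list bool)) u :
  In u l -> length u <= list_max (map (@length bool) l).
Proof.
elim: l => //= a l IH [->|/IH]; lia.
Qed.

Lemma partition_prefix P x : is_partition P ->
  exists i, i < length P /\ is_prefix (nth i P []) x.
Proof. by move=> h; have [i [hi _]] := h x; exists i. Qed.

Lemma partition_uniq P x i j : is_partition P -> i < length P -> j < length P ->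
  is_prefix (nth i P []) x -> is_prefix (nth j P []) x -> i = j.
Proof.
move=> h hi hj hpi hpj; have [k [_ hk]] := h x.
by rewrite -(hk i) // -(hk j).
Qed.

(** Bijectivity comes from both families being partitions; at the maximal length of a source word,
    every cone lies inside a source cone. *)
Lemma isV_isV' f : isV f -> isV' f.
Proof.
move=> [P [Q [hl [hP [hQ hf]]]]]; split; last first.
  exists (list_max (map (@length bool) P)) => x.
  have [i [hi hx]] := partition_prefix x hP.
  have hle := in_list_max _ _ (nth_In P [] hi).
  have [s hs] := prefix_split hx (prefix_take _ x)
    ltac:(by rewrite length_take; apply: hle).
  exists (nth i Q [] ++ s) => z.
  by rewrite hs !app_word_app hf.
have hs : forall y, exists x, f x = y.
  move=> y; have [i [hi hy]] := partition_prefix y hQ.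
  exists (app_word (nth i P []) (shift (length (nth i Q [])) y)).
  by rewrite hf ?hl // app_shift.
have hinj : forall x x', f x = f x' -> x = x'.
  move=> x x'.
  have [i [hi hx]] := partition_prefix x hP.
  have [j [hj hx']] := partition_prefix x' hP.
  rewrite -(app_shift hx) -(app_shift hx') !hf // => he.
  have hij : i = j.
    have hpi := prefix_app (nth i Q []) (shift (length (nth i P [])) x).
    apply: (partition_uniq hQ _ _ hpi); rewrite -?hl //.
    by rewrite he; apply: prefix_app.
  by subst j; rewrite (app_word_injr he).
pose g y := proj1_sig (constructive_indefinite_description _ (hs y)).
have hg : forall y, f (g y) = y.
  by move=> y; rewrite /g; case: constructive_indefinite_description.
by exists g; split=> // x; apply: hinj; rewrite hg.
Qed.

Fixpoint words (n : nat) : list (list bool) :=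
  match n with
  | 0 => [[]]
  | S n => map (cons false) (words n) ++ map (cons true) (words n)
  end.

Lemma In_words n u : In u (words n) <-> length u = n.
Proof.
elim: n u => [|n IH] u /=.
  split=> [[<-|[]]//|]; case: u => //= _; by left.
rewrite in_app_iff !in_map_iff; split.
  by move=> [] [w [<- /IH <-]].
case: u => [|[] u] //= [hu]; [right|left]; exists u; split=> //; exact/IH.
Qed.

Lemma NoDup_words n : NoDup (words n).
Proof.
elim: n => [|n IH] /=; first by apply: NoDup_cons; [case|apply: NoDup_nil].
apply: NoDup_app.
- by apply: NoDup_map_NoDup_ForallPairs => // u w _ _ [].
- by apply: NoDup_map_NoDup_ForallPairs => // u w _ _ [].
- move=> u; rewrite !in_map_iff => [] [w [<- _]] [w' [h _]]; discriminate.
Qed.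

Lemma words_partition n : is_partition (words n).
Proof.
move=> x.
have hin : In (take n x) (words n) by apply/In_words; rewrite length_take.
have [i [hi he]] := In_nth _ _ [] hin.
exists i; split; first by split=> //; rewrite he; apply: prefix_take.
move=> j [hj hp].
apply: (proj1 (NoDup_nth (words n) []) (NoDup_words n)) => //.
rewrite he (prefix_eq_take hp).
by have /In_words -> := nth_In (words n) [] hj.
Qed.

(** All words of length [n] form the source partition; their targets form a partition because [f] is
    bijective. *)
Lemma isV'_isV f : isV' f -> isV f.
Proof.
move=> [[g [hgf hfg]] [n hn]].
pose tgt u := epsilon (inhabits []) (fun w => forall z, f (app_word u z) = app_word w z).
have htgt : forall u z, In u (words n) -> f (app_word u z) = app_word (tgt u) z.
  move=> u z /In_words hu.
  apply: (epsilon_spec (inhabits []) (fun w => forall z, f (app_word u z) = app_word w z)).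
  by have := hn (app_word u zeros); rewrite -{1}hu -(prefix_eq_take (prefix_app _ _)).
(* [map_nth] forces the default [tgt []]; for indices in range it can then be replaced by [[]]. *)
have hnth : forall i, nth i (map tgt (words n)) (tgt []) = tgt (nth i (words n) []).
  by move=> i; rewrite map_nth.
have hnth' : forall i, i < length (words n) ->
    nth i (map tgt (words n)) [] = tgt (nth i (words n) []).
  move=> i hi; rewrite -hnth; apply: nth_indep; by rewrite length_map.
exists (words n), (map tgt (words n)); rewrite length_map.
split=> //; split; first exact: words_partition.
split; last by move=> i z hi; rewrite hnth' // htgt //; apply: nth_In.
move=> y; have [i [[hi hp] hu]] := words_partition n (g y).
exists i; split.
  rewrite length_map hnth' //; split=> //.
  have := htgt _ (shift (length (nth i (words n) [])) (g y)) (nth_In _ [] hi).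
  rewrite app_shift // hfg => ->; exact: prefix_app.
move=> j; rewrite length_map => [] [hj hpj]; apply: hu; split=> //.
move: hpj; rewrite hnth' // => hpj.
have := htgt _ (shift (length (tgt (nth j (words n) []))) y) (nth_In _ [] hj).
rewrite app_shift // => <-; rewrite hgf; exact: prefix_app.
Qed.

Lemma isV'_id : isV' (fun x => x).
Proof.
split; first by exists (fun x => x).
by exists 0 => x; exists (take 0 x).
Qed.

(** After [g] has replaced the first [m] digits of a word of length [m + n], at least [n] digits
    remain, as many as [f] needs. *)
Lemma isV'_comp f g : isV' f -> isV' g -> isV' (fun x => f (g x)).
Proof.
move=> [[f' [hf1 hf2]] [n hn]] [[g' [hg1 hg2]] [m hm]]; split.
  exists (fun x => g' (f' x)); split=> x; first by rewrite hf1.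
  by rewrite hg2.
exists (m + n) => x.
have [w hw] := hm x.
have [s hs] := prefix_split (prefix_take m x) (prefix_take (m + n) x)
  ltac:(by rewrite !length_take; lia).
have hsl : length s = n.
  by have := length_take (m + n) x; rewrite hs length_app length_take; lia.
have [v hv] := hn (app_word (w ++ s) zeros).
have [t ht] := prefix_split (prefix_take n (app_word (w ++ s) zeros))
   (prefix_app (w ++ s) zeros) ltac:(by rewrite length_take length_app; lia).
exists (v ++ t) => z.
by rewrite hs app_word_app hw -app_word_app ht app_word_app hv -app_word_app.
Qed.

(** A sufficient depth for the inverse is the maximal length of a target word: the prefix of [y] of
    that length extends the target through [y]. *)
Lemma isV'_inv f g : (forall x, g (f x) = x) -> (forall x, f (g x) = x) ->
  isV' f -> isV' g.
Proof.
move=> hgf hfg [_ [n hn]]; split; first by exists f.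
pose tgt u := epsilon (inhabits []) (fun w => forall z, f (app_word u z) = app_word w z).
have htgt : forall u z, length u = n -> f (app_word u z) = app_word (tgt u) z.
  move=> u z hu.
  apply: (epsilon_spec (inhabits []) (fun w => forall z, f (app_word u z) = app_word w z)).
  by have := hn (app_word u zeros); rewrite -{1}hu -(prefix_eq_take (prefix_app _ _)).
exists (list_max (map (@length bool) (map tgt (words n)))) => y.
set N := list_max _.
have hu := length_take n (g y).
have hle : length (tgt (take n (g y))) <= N.
  by apply/in_list_max/in_map/In_words.
have hp : is_prefix (tgt (take n (g y))) y.
  by rewrite -{2}(hfg y) -{2}(take_shift n (g y)) htgt //; apply: prefix_app.
have [s hs] := prefix_split hp (prefix_take N y) ltac:(by rewrite length_take).
exists (take n (g y) ++ s) => z.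
by rewrite hs !app_word_app -htgt // hgf.
Qed.

Definition Vcar : Type := {f : cantor -> cantor | isV f}.

Lemma sig_inj (A : Type) (P : A -> Prop) (x y : sig P) :
  proj1_sig x = proj1_sig y -> x = y.
Proof. case: x y => x p [y q] /= h; subst y; by rewrite (proof_irrelevance _ p q). Qed.

Definition vfun (v : Vcar) : cantor -> cantor := proj1_sig v.

Lemma vP (v : Vcar) : isV' (vfun v).
Proof. exact: isV_isV' (proj2_sig v). Qed.

Definition vmul (v w : Vcar) : Vcar :=
  exist _ (fun x => vfun v (vfun w x)) (isV'_isV (isV'_comp (vP v) (vP w))).
Definition vone : Vcar := exist _ _ (isV'_isV isV'_id).

Lemma vinv_ex (v : Vcar) : exists w : Vcar,
  (forall x, vfun w (vfun v x) = x) /\ (forall x, vfun v (vfun w x) = x).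
Proof.
have hv := vP v; have [[g [h1 h2]] _] := hv.
by exists (exist _ g (isV'_isV (isV'_inv _ h1 h2 hv))).
Qed.

Definition vinv (v : Vcar) : Vcar :=
  proj1_sig (constructive_indefinite_description _ (vinv_ex v)).

Lemma vinvK v x : vfun (vinv v) (vfun v x) = x.
Proof. by rewrite /vinv; case: constructive_indefinite_description => w [] /=. Qed.

Lemma vinvKV v x : vfun v (vfun (vinv v) x) = x.
Proof. by rewrite /vinv; case: constructive_indefinite_description => w [] /=. Qed.

Lemma vext (v w : Vcar) : (forall x, vfun v x = vfun w x) -> v = w.
Proof. by move=> h; apply: sig_inj; extensionality x; apply: h. Qed.

Definition Vgrp : group.
Proof.
refine (@Group Vcar vmul vone vinv _ _ _).
- by move=> x y z; apply: vext.
- by move=> x; apply: vext.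
- by move=> x; apply: vext => z; apply: vinvK.
Defined.

Lemma vinj (v : Vcar) x y : vfun v x = vfun v y -> x = y.
Proof. by move=> h; rewrite -(vinvK v x) h vinvK. Qed.

Lemma vlocal (v : Vcar) x m : exists u w, is_prefix u x /\ m <= length u /\ m <= length w /\
  (forall z, vfun v (app_word u z) = app_word w z).
Proof.
have [_ [n hn]] := vP v.
have [w hw] := hn x.
have [s hs] := prefix_split (prefix_take n x) (prefix_take (n + m) x)
  ltac:(by rewrite !length_take; lia).
have hl : length s = m.
  by have := length_take (n + m) x; rewrite hs length_app length_take; lia.
exists (take (n + m) x), (w ++ s); split; first exact: prefix_take.
rewrite length_app length_take; split; first lia; split; first lia.
by move=> z; rewrite hs !app_word_app hw.
Qed.

Definition qw (x : Q2) : cantor := proj1_sig x.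

Lemma qinj (x y : Q2) : qw x = qw y -> x = y.
Proof. exact: sig_inj. Qed.

Lemma vfun_ev0 (v : Vcar) x : ev0 x -> ev0 (vfun v x).
Proof.
move=> hx; have [u [w [hu [_ [_ h]]]]] := vlocal v x 0.
move: hx; rewrite -(app_shift hu) h => /(proj2 (ev0_app u _)).
exact: (proj1 (ev0_app w _)).
Qed.

Definition av (v : Vcar) (x : Q2) : Q2 :=
  exist _ (vfun v (qw x)) (@vfun_ev0 v (qw x) (proj2_sig x)).

Definition qapp (u : list bool) : Q2 := exist _ (app_word u zeros) (proj1 (ev0_app u zeros) ev0_zeros).

Lemma av_mul v w x : av (vmul v w) x = av v (av w x).
Proof. exact: qinj. Qed.
Lemma av_one x : av vone x = x.
Proof. exact: qinj. Qed.
Lemma avK v x : av (vinv v) (av v x) = x.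
Proof. apply: qinj; exact: vinvK. Qed.
Lemma avKV v x : av v (av (vinv v) x) = x.
Proof. apply: qinj; exact: vinvKV. Qed.
Lemma av_inj v x y : av v x = av v y -> x = y.
Proof. by move=> h; rewrite -(avK v x) h avK. Qed.

Lemma q2_tail (x : Q2) : exists N, forall n, N <= n -> qw x = app_word (take n (qw x)) zeros.
Proof.
have [N hN] := proj2_sig x; exists N => n hn.
rewrite -{1}(take_shift n (qw x)); congr app_word.
by extensionality i; apply: hN; lia.
Qed.

Lemma q2_split (x : Q2) N : exists n, N <= n /\ qw x = app_word (take n (qw x)) zeros.
Proof.
have [M hM] := q2_tail x; exists (N + M); split; first lia.
by apply: hM; lia.
Qed.

(** * Slopes *)

Definition sl (v : Vcar) (x : Q2) : Z := logslope (vfun v) (qw x).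

(** Of two source words through [x] the longer extends the shorter, and its target is extended by
    the same suffix. *)
Lemma slope_uniq (v : Vcar) x u w u' w' :
  is_prefix u x -> (forall z, vfun v (app_word u z) = app_word w z) ->
  is_prefix u' x -> (forall z, vfun v (app_word u' z) = app_word w' z) ->
  (Z.of_nat (length u) - Z.of_nat (length w) =
   Z.of_nat (length u') - Z.of_nat (length w'))%Z.
Proof.
wlog hl : u w u' w' / length u <= length u'.
  move=> hw h1 h2 h3 h4; case: (Nat.le_ge_cases (length u) (length u')) => h.
    exact: hw.
  by symmetry; apply: hw.
move=> h1 h2 h3 h4.
have [s hs] := prefix_split h1 h3 hl; subst u'.
have -> : w' = w ++ s.
  apply: app_word_determined => z _.
  by rewrite app_word_app -h2 -app_word_app h4.
by rewrite !length_app; lia.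
Qed.

Lemma sl_eq (v : Vcar) (x : Q2) u w : is_prefix u (qw x) ->
  (forall z, vfun v (app_word u z) = app_word w z) ->
  sl v x = (Z.of_nat (length u) - Z.of_nat (length w))%Z.
Proof.
move=> h1 h2; rewrite /sl /logslope.
case: excluded_middle_informative => [h|[]]; last by eexists; exists u, w.
case: constructive_indefinite_description => k /= [u' [w' [h1' [h2' ->]]]].
exact: slope_uniq h1' h2' h1 h2.
Qed.

Lemma sl_mul v w x : sl (vmul v w) x = (sl v (av w x) + sl w x)%Z.
Proof.
have [p [q [hp [hm [_ hpq]]]]] := vlocal v (qw (av w x)) 0.
(* The target [t] is taken at least as long as [p], so that it extends [p] and the two replacements
   compose. *)
have [u [t [hu [_ [ht hut]]]]] := vlocal w (qw x) (length p).
have hp' : is_prefix t (qw (av w x)).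
  by rewrite /= -(app_shift hu) hut; apply: prefix_app.
have [s hs] := prefix_split hp hp' ht; subst t.
rewrite (sl_eq _ _ hp hpq) (sl_eq _ _ hu hut).
rewrite (@sl_eq _ _ u (q ++ s)) ?length_app //; last lia.
by move=> z; rewrite /= hut app_word_app hpq app_word_app.
Qed.

Lemma sl_one x : sl vone x = 0%Z.
Proof. by rewrite (@sl_eq _ _ [] []) //; apply: prefix_nil. Qed.

Definition nearid (v : Vcar) (x : Q2) : Prop :=
  exists u, is_prefix u (qw x) /\ forall z, vfun v (app_word u z) = app_word u z.

Lemma nearid_fix v x : nearid v x -> av v x = x.
Proof. by move=> [u [h1 h2]]; apply: qinj; rewrite /= -(app_shift h1) h2. Qed.

Lemma nearid_sl v x : nearid v x -> sl v x = 0%Z.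
Proof. by move=> [u [h1 h2]]; rewrite (sl_eq _ _ h1 h2); lia. Qed.

(** At a fixed point of slope 1, the source and target words are prefixes of [x] of the same
    length. *)
Lemma sl0_nearid v x : av v x = x -> sl v x = 0%Z -> nearid v x.
Proof.
move=> hx hs; have [u [w [h1 [_ [_ h2]]]]] := vlocal v (qw x) 0.
exists u; split=> //.
have hw : is_prefix w (qw x).
  by rewrite -hx /= -(app_shift h1) h2; apply: prefix_app.
move: hs; rewrite (sl_eq _ _ h1 h2) => hs.
have hl : length u = length w by lia.
by rewrite {2}(prefix_eq_take h1) hl -(prefix_eq_take hw).
Qed.

Lemma nearid_supp v x u : (forall z, ~ is_prefix u z -> vfun v z = z) ->
  ~ is_prefix u (qw x) -> nearid v x.
Proof.
move=> hv hx; exists (take (length u) (qw x)); split; first exact: prefix_take.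
move=> z; apply: hv => h; apply: hx; rewrite (prefix_eq_take h).
apply/prefix_take_iff => i hi; symmetry.
by move: i hi; apply/prefix_take_iff; apply: prefix_app.
Qed.

(** * Transpositions of cones and high transitivity *)

Definition disj (u w : list bool) : Prop :=
  forall x, is_prefix u x -> is_prefix w x -> False.

Lemma disj_sym u w : disj u w -> disj w u.
Proof. by move=> h x h1 h2; apply: (h x). Qed.

Lemma disj_cat u w s t : disj u w -> disj (u ++ s) (w ++ t).
Proof. move=> h x /prefix_cat h1 /prefix_cat h2; exact: h h1 h2. Qed.

Lemma disj_same u s t : disj s t -> disj (u ++ s) (u ++ t).
Proof.
move=> h x h1; rewrite -(app_shift (prefix_cat _ _ h1)) => /prefix_cat_app.
move: (h1); rewrite -{1}(app_shift (prefix_cat _ _ h1)) => /prefix_cat_app.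
exact: h.
Qed.

Lemma disj_bool b s t : disj (b :: s) (negb b :: t).
Proof.
move=> x h1 h2; have := h1 0; have := h2 0 => /=.
move=> /(_ ltac:(lia)) <- /(_ ltac:(lia)); by case: b {h1 h2}.
Qed.

Lemma disj_take (x y : cantor) i n m : x i <> y i -> i < n -> i < m ->
  disj (take n x) (take m y).
Proof.
move=> h hn hm z /prefix_take_iff h1 /prefix_take_iff h2.
by apply: h; rewrite -h1 // h2.
Qed.

Definition is_swap (u w : list bool) (t : Vcar) : Prop :=
  (forall z, vfun t (app_word u z) = app_word w z) /\
  (forall z, vfun t (app_word w z) = app_word u z) /\
  (forall z, ~ is_prefix u z -> ~ is_prefix w z -> vfun t z = z).

Lemma swap_ex u w : disj u w -> exists t, is_swap u w t.
Proof.
move=> hd.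
pose f x := if excluded_middle_informative (is_prefix u x) is left _
  then app_word w (shift (length u) x)
  else if excluded_middle_informative (is_prefix w x) is left _
  then app_word u (shift (length w) x) else x.
have f1 : forall z, f (app_word u z) = app_word w z.
  move=> z; rewrite /f; case: excluded_middle_informative => [h|[]].
    by rewrite shift_app_word.
  exact: prefix_app.
have f2 : forall z, f (app_word w z) = app_word u z.
  move=> z; rewrite /f; case: excluded_middle_informative => [h|h].
    by case: (hd _ h (prefix_app _ _)).
  case: excluded_middle_informative => [h'|[]]; last exact: prefix_app.
  by rewrite shift_app_word.
have f3 : forall z, ~ is_prefix u z -> ~ is_prefix w z -> f z = z.
  move=> z h1 h2; rewrite /f; case: excluded_middle_informative => // _.
  by case: excluded_middle_informative.
have finv : forall x, f (f x) = x.
  move=> x; case: (classic (is_prefix u x)) => hu.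
    by rewrite -(app_shift hu) f1 f2.
  case: (classic (is_prefix w x)) => hw.
    by rewrite -(app_shift hw) f2 f1.
  by rewrite !f3 // f3.
have hV : isV' f.
  split; first by exists f.
  (* At this depth every cone lies inside [u], inside [w], or outside both. *)
  exists (length u + length w) => x.
  case: (classic (is_prefix u x)) => hu.
    have [s hs] := prefix_split hu (prefix_take (length u + length w) x)
      ltac:(rewrite length_take; lia).
    by exists (w ++ s) => z; rewrite hs !app_word_app f1.
  case: (classic (is_prefix w x)) => hw.
    have [s hs] := prefix_split hw (prefix_take (length u + length w) x)
      ltac:(rewrite length_take; lia).
    by exists (u ++ s) => z; rewrite hs !app_word_app f2.
  exists (take (length u + length w) x) => z.
  have hp := prefix_app (take (length u + length w) x) z.
  move/prefix_take_iff: hp => hp.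
  apply: f3 => hc; [apply: hu|apply: hw] => i hi; rewrite hc // hp //; lia.
by exists (exist _ f (isV'_isV hV)).
Qed.

Lemma is_swap_inv u w t x : is_swap u w t -> vfun t (vfun t x) = x.
Proof.
move=> [f1 [f2 f3]]; case: (classic (is_prefix u x)) => hu.
  by rewrite -(app_shift hu) f1 f2.
case: (classic (is_prefix w x)) => hw.
  by rewrite -(app_shift hw) f2 f1.
by rewrite !f3 // f3.
Qed.

Lemma swap_nearid u w t x : is_swap u w t ->
  ~ is_prefix u (qw x) -> ~ is_prefix w (qw x) -> nearid t x.
Proof.
move=> [_ [_ h]] hu hw.
exists (take (length u + length w) (qw x)); split; first exact: prefix_take.
move=> z; apply: h => hp; [apply: hu|apply: hw] => i hi;
 rewrite hp // app_word_lt ?length_take ?nth_take //; lia.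
Qed.

(* A transposition of two cones is the square of the 4-cycle
   u0 -> w1 -> w0 -> u1 -> u0 of half cones. *)
Lemma swap_sqrt u w t : disj u w -> is_swap u w t -> exists c, vmul c c = t /\
  forall z, ~ is_prefix u z -> ~ is_prefix w z -> vfun c z = z.
Proof.
move=> hd [h1 [h2 h3]].
have [t1 [a1 [a2 a3]]] := swap_ex (@disj_same u _ _ (@disj_bool false [] [])).
have [t2 [b1 [b2 b3]]] := swap_ex (@disj_same w _ _ (@disj_bool false [] [])).
have [t3 [c1 [c2 c3]]] := swap_ex (@disj_cat _ _ [false] [false] hd).
rewrite /= in a1 a2 a3 b1 b2 b3.
have hdd := fun s t => @disj_cat u w s t hd.
have dd := fun u => @disj_same u _ _ (@disj_bool false [] []).
have nd : forall p q z, disj p q -> ~ is_prefix q (app_word p z).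
  move=> p q z h h'; apply: h h'; exact: prefix_app.
exists (vmul t1 (vmul t2 t3)).
have e1 : forall z, vfun (vmul t1 (vmul t2 t3)) (app_word (u ++ [false]) z) = app_word (w ++ [true]) z.
  move=> z /=; rewrite c1 b1 a3 //; apply: nd; exact: disj_sym.
have e2 : forall z, vfun (vmul t1 (vmul t2 t3)) (app_word (w ++ [true]) z) = app_word (w ++ [false]) z.
  move=> z /=; rewrite c3; try (apply: nd; apply: disj_sym; by [apply: dd | apply: hdd]).
  rewrite b2 a3 //; apply: nd; exact: disj_sym.
have e3 : forall z, vfun (vmul t1 (vmul t2 t3)) (app_word (w ++ [false]) z) = app_word (u ++ [true]) z.
  move=> z /=; rewrite c2 b3 ?a1 //; apply: nd; exact: hdd.
have e4 : forall z, vfun (vmul t1 (vmul t2 t3)) (app_word (u ++ [true]) z) = app_word (u ++ [false]) z.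
  move=> z /=; rewrite c3; try (apply: nd; by [apply: disj_sym; apply: dd | apply: hdd]).
  rewrite b3 ?a2 //; apply: nd; exact: hdd.
have e5 : forall z, ~ is_prefix u z -> ~ is_prefix w z -> vfun (vmul t1 (vmul t2 t3)) z = z.
  move=> z hu hw /=; rewrite c3; try by move=> /prefix_cat.
  by rewrite b3 ?a3 => // /prefix_cat.
split=> //; apply: vext => x.
have hb : forall p z, app_word p z = app_word (p ++ [z 0]) (shift 1 z).
  move=> p z; rewrite app_word_app; congr app_word.
  by have := take_shift 1 z.
move: (vmul t1 _) e1 e2 e3 e4 e5 => c e1 e2 e3 e4 e5.
have -> : vfun (vmul c c) x = vfun c (vfun c x) by [].
case: (classic (is_prefix u x)) => hu.
  rewrite -(app_shift hu) h1; set z := shift _ _.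
  rewrite (hb u) (hb w); case: (z 0); by rewrite ?(e4, e1, e2, e3).
case: (classic (is_prefix w x)) => hw.
  rewrite -(app_shift hw) h2; set z := shift _ _.
  rewrite (hb u) (hb w); case: (z 0); by rewrite ?(e2, e3, e4, e1).
by rewrite h3 // !e5 // e5.
Qed.

Lemma cantor_neq (x y : cantor) : x <> y -> exists i, x i <> y i.
Proof.
move=> h; apply: NNPP => h'; apply: h; extensionality i.
by apply: NNPP => hi; apply: h'; exists i.
Qed.

Lemma separate (x : Q2) (F : list Q2) : ~ In x F ->
  exists N, forall n, N <= n -> forall f, In f F -> ~ is_prefix (take n (qw x)) (qw f).
Proof.
elim: F => [|f F IH] /= hx; first by exists 0.
have [N hN] := IH ltac:(tauto).
have [i hi] : exists i, qw x i <> qw f i by apply: cantor_neq => /qinj h; apply: hx; left.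
exists (N + S i) => n hn g [<-|hg]; last by apply: hN => //; lia.
move=> /prefix_take_iff /(_ i) h; apply: hi; rewrite h //; lia.
Qed.

(** Swap two disjoint cones around [p] and [q] that miss [F]. They are taken so deep that [p] and
    [q] have zero tails in them, hence [p] goes exactly to [q]. *)
Lemma high_trans (p q : Q2) (F : list Q2) : p <> q -> ~ In p F -> ~ In q F ->
  exists t, av t p = q /\ forall f, In f F -> nearid t f.
Proof.
move=> hpq hp hq.
have [Np hNp] := separate _ _ hp.
have [Nq hNq] := separate _ _ hq.
have [i hi] : exists i, qw p i <> qw q i by apply: cantor_neq => /qinj.
have [n [hn en]] := q2_split p (Np + S i).
have [m [hm em]] := q2_split q (Nq + S i).
have hd : disj (take n (qw p)) (take m (qw q)) by apply: (@disj_take _ _ i) => //; lia.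
have [t ht] := swap_ex hd; exists t; split.
  by case: ht => h _; apply: qinj; rewrite /= en h -em.
move=> f hf; apply: (swap_nearid _ ht); [apply: hNp|apply: hNq] => //; lia.
Qed.

Definition qpt (n : nat) : Q2 := qapp (repeat true n).

Lemma qpt_inj n m : qpt n = qpt m -> n = m.
Proof.
have h : forall n m, n < m -> qpt n <> qpt m.
  move=> {}n {}m hnm he.
  have := f_equal (fun x => qw x (length (repeat true n) + 0)) he.
  rewrite /= app_word_ge app_word_lt !repeat_length; first lia.
  by rewrite nth_repeat_lt; first lia.
move=> he; case: (Nat.lt_trichotomy n m) => [/h|[//|/h]] hh; case: hh => //.
Qed.

Lemma fresh (F : list Q2) : exists q : Q2, ~ In q F.
Proof.
have [n hn] : exists n, forall m, n <= m -> ~ In (qpt m) F.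
  elim: F => [|f F [n IH]]; first by exists 0 => m _ [].
  case: (classic (exists k, qpt k = f)) => [[k hk]|hk].
    exists (n + S k) => m hm [|]; last by apply: IH; lia.
    rewrite -hk => /qpt_inj; lia.
  exists n => m hm [h|]; last exact: IH.
  by apply: hk; exists m.
by exists (qpt n); apply: hn.
Qed.

Lemma V_moves (v : Vcar) : v <> vone -> exists x, av v x <> x.
Proof.
move=> hv; apply: NNPP => h; apply: hv; apply: vext => x.
have [u [w [hu [_ [_ huw]]]]] := vlocal v x 0.
suff e : u = w by rewrite -(app_shift hu) huw e.
apply: app_word_determined => z /(ev0_app u) hz.
rewrite -huw; apply: NNPP => hne; apply: h.
exists (exist _ (app_word u z) hz) => he; apply: hne.
by have := f_equal qw he => /= ->.
Qed.

Unset Strict Implicit.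

(** * The group K x| V *)

Notation "x ** y" := (gmul x y) (at level 40, left associativity).

Lemma gmulVr (G : group) (x : G) : x ** ginv x = gone.
Proof.
rewrite -(gmul1l _ (x ** ginv x)) -{1}(gmulVl _ (ginv x)).
by rewrite gmulA -(gmulA _ (ginv (ginv x))) gmulVl -gmulA gmul1l gmulVl.
Qed.

Lemma gmul1r (G : group) (x : G) : x ** gone = x.
Proof. by rewrite -(gmulVl _ x) gmulA gmulVr gmul1l. Qed.

Lemma gmulKl (G : group) (x y : G) : ginv x ** (x ** y) = y.
Proof. by rewrite gmulA gmulVl gmul1l. Qed.

Lemma gmulKVl (G : group) (x y : G) : x ** (ginv x ** y) = y.
Proof. by rewrite gmulA gmulVr gmul1l. Qed.

Lemma gmulKr (G : group) (x y : G) : y ** x ** ginv x = y.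
Proof. by rewrite -gmulA gmulVr gmul1r. Qed.

Lemma gmulKVr (G : group) (x y : G) : y ** ginv x ** x = y.
Proof. by rewrite -gmulA gmulVl gmul1r. Qed.

Lemma gmulIl (G : group) (x y z : G) : x ** y = x ** z -> y = z.
Proof. by move=> h; rewrite -(gmulKl x y) h gmulKl. Qed.

Lemma gmulIr (G : group) (x y z : G) : y ** x = z ** x -> y = z.
Proof. by move=> h; rewrite -(gmulKr x y) h gmulKr. Qed.

Lemma ginv_uniq (G : group) (x y : G) : x ** y = gone -> y = ginv x.
Proof. by move=> h; apply: (@gmulIl _ x); rewrite h gmulVr. Qed.

Lemma ginvM (G : group) (x y : G) : ginv (x ** y) = ginv y ** ginv x.
Proof. by symmetry; apply: ginv_uniq; rewrite gmulA gmulKr gmulVr. Qed.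

Lemma ginvV (G : group) (x : G) : ginv (ginv x) = x.
Proof. by symmetry; apply: ginv_uniq; rewrite gmulVl. Qed.

Lemma ginv1 (G : group) : ginv (@gone G) = gone.
Proof. by symmetry; apply: ginv_uniq; rewrite gmul1l. Qed.

Lemma hom1 (G H : group) (f : G -> H) : is_hom _ _ f -> f gone = gone.
Proof. by move=> h; apply: (@gmulIl _ (f gone)); rewrite -h !gmul1r. Qed.

Lemma homV (G H : group) (f : G -> H) x : is_hom _ _ f -> f (ginv x) = ginv (f x).
Proof. by move=> h; apply: ginv_uniq; rewrite -h gmulVr hom1. Qed.

Lemma hom_ad (G H : group) (f : G -> H) h x : is_hom _ _ f -> f (ad h x) = ad (f h) (f x).
Proof. by move=> hf; rewrite /ad !hf homV. Qed.

Lemma ad_hom (G : group) (h : G) : is_hom G G (ad h).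
Proof. by move=> x y; rewrite /ad !gmulA gmulKVr. Qed.

Lemma ad_inj (G : group) (h x y : G) : ad h x = ad h y -> x = y.
Proof. by move=> /gmulIr /gmulIl. Qed.

Lemma ad1 (G : group) (x : G) : ad gone x = x.
Proof. by rewrite /ad gmul1l ginv1 gmul1r. Qed.

Lemma adM (G : group) (g h x : G) : ad (g ** h) x = ad g (ad h x).
Proof. by rewrite /ad ginvM !gmulA. Qed.

Lemma iso_inv_hom (G H : group) (f : giso G H) : is_hom _ _ (iso_inv f).
Proof.
by move=> x y; rewrite -{1}(iso_funK f x) -{1}(iso_funK f y) -iso_hom iso_invK.
Qed.

Definition giso_sym (G H : group) (f : giso G H) : giso H G :=
  @GIso H G (iso_inv f) f (@iso_inv_hom G H f) (iso_funK f) (iso_invK f).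

Lemma giso_inj (G H : group) (f : giso G H) x y : f x = f y -> x = y.
Proof. by move=> h; rewrite -(iso_invK f x) h iso_invK. Qed.

Lemma giso_of_bij (G H : group) (f : G -> H) : is_hom _ _ f ->
  (forall x y, f x = f y -> x = y) -> (forall y, exists x, f x = y) ->
  exists F : giso G H, forall x, F x = f x.
Proof.
move=> hh hi hs.
pose g y := proj1_sig (constructive_indefinite_description _ (hs y)).
have hg : forall y, f (g y) = y.
  by move=> y; rewrite /g; case: constructive_indefinite_description.
have hgf : forall x, g (f x) = x by move=> x; apply: hi; rewrite hg.
by exists (@GIso G H f g hh hgf hg).
Qed.

(** The recursion of [aut_pow] for arbitrary maps, since [twist] iterates a map that need not be a
    homomorphism. *)
Definition iterZ (T : Type) (f g : T -> T) (k : Z) : T -> T :=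
  match k with
  | Z0 => fun x => x
  | Zpos p => Nat.iter (Pos.to_nat p) f
  | Zneg p => Nat.iter (Pos.to_nat p) g
  end.

Lemma iterZ_succ (T : Type) (f g : T -> T) (hfg : forall x, f (g x) = x) k x :
  iterZ f g (k + 1) x = f (iterZ f g k x).
Proof.
case: k => [|p|p] //=.
  by rewrite Pos2Nat.inj_add Nat.add_comm.
case: (Pos.eq_dec p 1) => [->|hp] //=.
have [q ->] : exists q, p = Pos.succ q by exists (Pos.pred p); lia.
have -> : (Z.pos_sub 1 (Pos.succ q)) = Zneg q by rewrite -(Pos2Z.add_pos_neg 1); lia.
by rewrite Pos2Nat.inj_succ /= hfg.
Qed.

(** The two-way step covers negative exponents as well; going down, it is proved by cancelling an
    injective map. *)
Lemma Z_ind2 (P : Z -> Prop) : P 0%Z -> (forall k, P k <-> P (k + 1)%Z) -> forall k, P k.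
Proof.
move=> h0 hs; apply: Z.peano_ind => // k; first by move/hs.
by move=> h; apply/hs; have -> : (Z.pred k + 1 = k)%Z by lia.
Qed.

Lemma aut_pow_succ (G : group) (al : aut G) k x :
  aut_pow al (k + 1) x = al (aut_pow al k x).
Proof. exact: (iterZ_succ (iso_funK al) k x). Qed.

Lemma aut_pow_add (G : group) (al : aut G) k l x :
  aut_pow al (k + l) x = aut_pow al k (aut_pow al l x).
Proof.
move: k; apply: Z_ind2 => // k.
have -> : (k + 1 + l = k + l + 1)%Z by lia.
rewrite !aut_pow_succ; split=> [-> //|]; exact: giso_inj.
Qed.

Lemma aut_pow_hom (G : group) (al : aut G) k : is_hom _ _ (aut_pow al k).
Proof.
move=> x y; move: k; apply: Z_ind2 => // k.
rewrite !aut_pow_succ -iso_hom; split=> [-> //|]; exact: giso_inj.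
Qed.

Lemma aut_pow_inj (G : group) (al : aut G) k x y : aut_pow al k x = aut_pow al k y -> x = y.
Proof.
move=> h; have := f_equal (aut_pow al (- k)) h.
by rewrite -!aut_pow_add Z.add_opp_diag_l.
Qed.

Definition actr (Gam : group) (al : aut Gam) (v : Vcar) (a : Q2 -> Gam) : Q2 -> Gam :=
  fun x => aut_pow al (- sl v (av (vinv v) x)) (a (av (vinv v) x)).

(** Membership in V is built into the type, so that the carrier is a genuine group; [emb] relates it
    to [Gcar]. *)
Definition Gc (Gam : group) : Type := ((Q2 -> Gam) * Vcar)%type.

Lemma actr_av (Gam : group) (al : aut Gam) v a x :
  actr al v a (av v x) = aut_pow al (- sl v x) (a x).
Proof. by rewrite /actr avK. Qed.

Lemma actr_mul (Gam : group) (al : aut Gam) v w a :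
  actr al (vmul v w) a = actr al v (actr al w a).
Proof.
extensionality x.
rewrite -(avKV v x) -(avKV w (av (vinv v) x)) -av_mul actr_av.
rewrite av_mul !actr_av -aut_pow_add sl_mul; congr aut_pow; lia.
Qed.

Lemma actr_one (Gam : group) (al : aut Gam) a : actr al vone a = a.
Proof. by extensionality x; rewrite -{1}(av_one x) actr_av sl_one. Qed.

Lemma actr_hom (Gam : group) (al : aut Gam) v a b :
  actr al v (fun x => a x ** b x) = (fun x => actr al v a x ** actr al v b x).
Proof. by extensionality x; rewrite /actr aut_pow_hom. Qed.

Definition Gm (Gam : group) (al : aut Gam) (g h : Gc Gam) : Gc Gam :=
  (fun x => fst g x ** actr al (snd g) (fst h) x, vmul (snd g) (snd h)).

Definition Gi (Gam : group) (al : aut Gam) (g : Gc Gam) : Gc Gam :=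
  (actr al (vinv (snd g)) (fun x => ginv (fst g x)), vinv (snd g)).

Definition Ggrp (Gam : group) (al : aut Gam) : group.
Proof.
refine (@Group (Gc Gam) (Gm al) (fun _ => gone, vone) (Gi al) _ _ _).
- move=> [a u] [b v] [c w]; rewrite /Gm /=; congr pair; last exact: (gmulA Vgrp).
  by extensionality x; rewrite actr_hom actr_mul gmulA.
- move=> [a u]; rewrite /Gm /= actr_one; congr pair; last exact: (gmul1l Vgrp).
  by extensionality x; rewrite gmul1l.
- move=> [a u]; rewrite /Gm /=; congr pair; last exact: (gmulVl Vgrp).
  extensionality x; rewrite /actr -aut_pow_hom gmulVl.
  apply: hom1; exact: aut_pow_hom.
Defined.

Definition ag (Gam : group) (g : Gc Gam) (x : Q2) : Q2 := av (snd g) x.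

Lemma ag_mul (Gam : group) (al : aut Gam) (g h : Ggrp al) x : ag (g ** h) x = ag g (ag h x).
Proof. exact: av_mul. Qed.

Lemma ag_inj (Gam : group) (g : Gc Gam) x y : ag g x = ag g y -> x = y.
Proof. exact: av_inj. Qed.

Lemma ag_surj (Gam : group) (g : Gc Gam) y : exists x, ag g x = y.
Proof. by exists (av (vinv (snd g)) y); rewrite /ag avKV. Qed.

Definition kk (Gam : group) (al : aut Gam) (a : Q2 -> Gam) : Ggrp al := (a, vone).
Definition vv (Gam : group) (al : aut Gam) (v : Vcar) : Ggrp al := (fun _ => gone, v).

Lemma kk_mul (Gam : group) (al : aut Gam) a b :
  kk al a ** kk al b = kk al (fun x => a x ** b x).
Proof. by rewrite /kk /= /Gm /= actr_one; congr pair; apply: vext. Qed.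

Lemma kk_one (Gam : group) (al : aut Gam) : kk al (fun _ => gone) = gone.
Proof. by []. Qed.

Lemma actr_1 (Gam : group) (al : aut Gam) v : actr al v (fun _ => gone) = fun _ => gone.
Proof. by extensionality x; apply: hom1; apply: aut_pow_hom. Qed.

Lemma vv_mul (Gam : group) (al : aut Gam) v w : vv al v ** vv al w = vv al (vmul v w).
Proof. by rewrite /vv /= /Gm /= actr_1; congr pair; extensionality x; rewrite gmul1l. Qed.

Lemma kk_vv (Gam : group) (al : aut Gam) (g : Ggrp al) : kk al (fst g) ** vv al (snd g) = g.
Proof.
case: g => a v; rewrite /vv /kk /= /Gm /= actr_1; congr pair; last exact: vext.
by extensionality x; rewrite gmul1r.
Qed.

Lemma kk_inj (Gam : group) (al : aut Gam) a b : kk al a = kk al b -> a = b.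
Proof. by case. Qed.

(* Conjugation by [g] on K is [star g]; it carries the coordinate at [y] to the
   one at [g y] through [coord_map g y]. *)
Definition coord_map (Gam : group) (al : aut Gam) (g : Gc Gam) (y : Q2) (c : Gam) : Gam :=
  ad (fst g (ag g y)) (aut_pow al (- sl (snd g) y) c).

Definition star (Gam : group) (al : aut Gam) (g : Gc Gam) (a : Q2 -> Gam) : Q2 -> Gam :=
  fun z => coord_map al g (av (vinv (snd g)) z) (a (av (vinv (snd g)) z)).

Lemma starE (Gam : group) (al : aut Gam) g a y : star al g a (ag g y) = coord_map al g y (a y).
Proof. by rewrite /star /ag avK. Qed.

Lemma star_mulE (Gam : group) (al : aut Gam) (g : Ggrp al) a :
  g ** kk al a = kk al (star al g a) ** g.
Proof.
case: g => c v; rewrite /kk /= /Gm /= actr_one; congr pair; last exact: vext.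
extensionality x; rewrite -(avKV v x) actr_av.
by rewrite (starE al (c, v) a) /coord_map /= /ag /= /ad gmulKVr.
Qed.

Lemma star_uniq (Gam : group) (al : aut Gam) (g : Ggrp al) a b :
  g ** kk al a = kk al b ** g -> b = star al g a.
Proof. by rewrite star_mulE => /gmulIr /kk_inj. Qed.

Lemma star_mul (Gam : group) (al : aut Gam) (g h : Ggrp al) a :
  star al (g ** h) a = star al g (star al h a).
Proof.
symmetry; apply: star_uniq.
by rewrite -gmulA star_mulE gmulA star_mulE -gmulA.
Qed.

Lemma coord_map_hom (Gam : group) (al : aut Gam) g y : is_hom _ _ (coord_map al g y).
Proof. by move=> a b; rewrite /coord_map aut_pow_hom ad_hom. Qed.

Lemma coord_map_inj (Gam : group) (al : aut Gam) g y a b : coord_map al g y a = coord_map al g y b -> a = b.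
Proof. by move=> /ad_inj /aut_pow_inj. Qed.

Lemma coord_map_vv (Gam : group) (al : aut Gam) v y c :
  coord_map al (vv al v) y c = aut_pow al (- sl v y) c.
Proof. by rewrite /coord_map ad1. Qed.

(** Points of the support of [a] are fixed with slope 1, so their values are kept; by injectivity no
    other point is carried into the support. *)
Lemma star_fix (Gam : group) (al : aut Gam) v (a : Q2 -> Gam) :
  (forall y, a y <> gone -> nearid v y) -> star al (vv al v) a = a.
Proof.
move=> h; extensionality z; rewrite -(avKV v z); set y := av _ z.
rewrite (starE al (vv al v)) coord_map_vv.
case: (classic (a y = gone)) => hy; last first.
  by rewrite nearid_sl ?nearid_fix //; apply: h.
rewrite hy (hom1 (aut_pow_hom al _)).
case: (classic (a (av v y) = gone)) => [-> //|hz].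
by have /av_inj hf := nearid_fix (h _ hz); rewrite hf hy in hz.
Qed.

Definition delta (Gam : group) (x : Q2) (c : Gam) : Q2 -> Gam :=
  fun z => if excluded_middle_informative (z = x) is left _ then c else gone.

Lemma delta_eq (Gam : group) x (c : Gam) : delta x c x = c.
Proof. by rewrite /delta; case: excluded_middle_informative. Qed.

Lemma delta_ne (Gam : group) x z (c : Gam) : z <> x -> delta x c z = gone.
Proof. by rewrite /delta; case: excluded_middle_informative. Qed.

Lemma star_delta (Gam : group) (al : aut Gam) (g : Ggrp al) x c :
  star al g (delta x c) = delta (ag g x) (coord_map al g x c).
Proof.
extensionality z; have [y <-] := ag_surj g z; rewrite starE.
case: (classic (y = x)) => [->|h]; first by rewrite !delta_eq.
rewrite !delta_ne //; first by move=> /ag_inj.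
exact: hom1 (@coord_map_hom _ _ _ _).
Qed.

(** * The kernel K is preserved by isomorphisms *)

Section PermutationGroups.

Implicit Types (L M N : Vcar -> Prop).

Notation conj v l := (vmul (vmul v l) (vinv v)).

(** High transitivity gives an element of V taking a point [r] moved by [l0] to [p], and its image
    under [l0] to [q]; it conjugates [l0] to the required element. *)
Lemma normal_trans L (l0 : Vcar) p q :
  (forall v l, L l -> L (conj v l)) -> L l0 -> l0 <> vone -> p <> q ->
  exists l, L l /\ av l p = q.
Proof.
move=> hL h0 /V_moves [r hr] hpq.
have [v [hv1 hv2]] : exists v, av v r = p /\ av v (av l0 r) = q.
  have [v1 hv1] : exists v1, av v1 r = p.
    case: (classic (r = p)) => hrp; first by exists vone; rewrite av_one.
    by have [t [ht _]] := @high_trans _ _ [] hrp ltac:(auto) ltac:(auto); exists t.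
  set s := av v1 (av l0 r).
  have hs : s <> p by rewrite -hv1 => /av_inj.
  case: (classic (s = q)) => hsq; first by exists v1.
  have hns : ~ In s [p] by case=> //; auto.
  have hnq : ~ In q [p] by case=> //; auto.
  have [t [ht1 ht2]] := high_trans _ hsq hns hnq.
  exists (vmul t v1); rewrite !av_mul hv1; split=> //.
  apply: nearid_fix; apply: ht2; by left.
exists (conj v l0); split; first exact: hL.
by rewrite !av_mul -hv1 avK -hv2.
Qed.

(* A commutator of an element of [L] with an element of small support. *)
Lemma normal_local L (l0 : Vcar) w F :
  (forall l l', L l -> L l' -> L (vmul l l')) ->
  (forall l, L l -> L (vinv l)) ->
  (forall v l, L l -> L (conj v l)) -> L l0 -> l0 <> vone -> ~ In w F ->
  exists l, L l /\ av l w <> w /\ forall f, In f F -> av l f = f.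
Proof.
move=> hM hV hL h0 h1 hw.
have [q hq] := fresh (w :: F).
have hwq : w <> q by move=> h; apply: hq; left.
have [l [hl hlw]] := normal_trans hL h0 h1 hwq.
(* These are the points that [g] must fix, while it moves [w] to [z]: then g l g^-1 l^-1 sends [w]
   to [z] and fixes [F]. *)
pose F' := av (vinv l) w :: F ++ map (av (vinv l)) F.
have hwF : ~ In w F'.
  rewrite /F' /= in_app_iff in_map_iff => [] [h|[//|[f [hf hfF]]]].
    by apply: hwq; rewrite -hlw -[in RHS]h avKV.
  by apply: hq; right; rewrite -hlw -hf avKV.
have [z hz] := fresh (w :: F').
have hwz : w <> z by move=> h; apply: hz; left.
have hzF : ~ In z F' by move=> h; apply: hz; right.
have [g [hg1 hg2]] := high_trans _ hwz hwF hzF.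
have hg : forall f, In f F' -> av (vinv g) f = f.
  move=> f hf; rewrite -{1}(nearid_fix (hg2 f hf)); exact: avK.
exists (vmul (conj g l) (vinv l)).
split; first by apply: hM; [apply: hL|apply: hV].
rewrite !av_mul; split.
  by rewrite hg; [left|rewrite avKV hg1; auto].
move=> f hf; rewrite !av_mul hg; last first.
  by rewrite avKV nearid_fix //; apply: hg2; right; apply/in_app_iff; left.
by right; apply/in_app_iff; right; apply: in_map.
Qed.

Lemma conj_eq1 v l : conj v l = vone -> l = vone.
Proof.
move=> h; apply: vext => x; apply: (@vinj v).
by have := f_equal (fun t => vfun t (vfun v x)) h; rewrite /= vinvK.
Qed.

Lemma normal_moves L P (l0 : Vcar) m w :
  (forall v l, L l -> L (conj v l)) -> L l0 -> l0 <> vone ->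
  (forall l m, L l -> P m -> P (conj l m)) -> P m -> m <> vone ->
  exists m, P m /\ av m w <> w.
Proof.
move=> hL h0 h1 hP hm /V_moves [p hp].
case: (classic (p = w)) => [<-|hpw]; first by exists m.
have [l [hl <-]] := normal_trans hL h0 h1 hpw.
exists (conj l m); split; first exact: hP.
by rewrite !av_mul avK => /av_inj.
Qed.

(** An element of [M] that fixes n(w) but moves [w] cannot commute with [n]. One is built from an
    [m] in [M] with m(w) distinct from [w] and n(w), perturbed by an element of [L]. *)
Lemma commuting_normal_factors L M N (s : Vcar) :
  (forall l l', L l -> L l' -> L (vmul l l')) ->
  (forall l, L l -> L (vinv l)) ->
  (forall v l, L l -> L (conj v l)) ->
  (forall l l', M l -> M l' -> M (vmul l l')) ->
  (forall l, M l -> M (vinv l)) ->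
  (forall l m, L l -> M m -> M (conj l m)) ->
  (forall l n, L l -> N n -> N (conj l n)) ->
  (forall m n, M m -> N n -> vmul m n = vmul n m) ->
  (forall l, L l -> exists m n, M m /\ N n /\ l = vmul m n) ->
  (forall m, M m -> N (conj s m)) ->
  (forall n, N n -> M (conj s n)) ->
  forall l, L l -> l = vone.
Proof.
move=> LM LV LJ MM MV MJ NJ comm fac sM sN l0 h0; apply: NNPP => h1.
have [m0 [n0 [hm0 [hn0 e]]]] := fac _ h0.
have [m1 [hm1 m1ne]] : exists m, M m /\ m <> vone.
  case: (classic (m0 = vone)) => hm; last by exists m0.
  exists (conj s n0); split; first exact: sN.
  by move=> /conj_eq1 hn; apply: h1; rewrite e hm hn; apply: (gmul1l Vgrp).
have [n1 [hn1 n1ne]] : exists n, N n /\ n <> vone.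
  by exists (conj s m1); split; [exact: sM|move=> /conj_eq1].
have [w0 _] := V_moves m1ne.
have [n [hn nw]] := normal_moves w0 LJ h0 h1 NJ hn1 n1ne.
move: w0 nw => w nw.
(* If m(w) = n(w), conjugate [m] by an element of [L] that fixes [w] and moves m(w). *)
have [m [hm [mw mnw]]] : exists m, M m /\ av m w <> w /\ av m w <> av n w.
  have [m [hm mw]] := normal_moves w LJ h0 h1 MJ hm1 m1ne.
  case: (classic (av m w = av n w)) => he; last by exists m.
  have hw : ~ In (av m w) [w] by case=> //; auto.
  have [l [hl [lw hl']]] := normal_local LM LV LJ h0 h1 hw.
  have lw' : av (vinv l) w = w by rewrite -{1}(hl' w (or_introl eq_refl)) avK.
  exists (conj l m); split; first exact: MJ.
  rewrite !av_mul lw' -he; split=> // h; apply: mw; apply: (@av_inj l).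
  by rewrite h hl' //; left.
have hne : ~ In (av m w) [w; av n w; av m (av n w)].
  by case=> [h|[h|[h|//]]]; [exact: mw|exact: mnw|apply: nw; exact: av_inj h].
have [l [hl [lw hl']]] := normal_local LM LV LJ h0 h1 hne.
have lV : forall f, In f [w; av n w; av m (av n w)] -> av (vinv l) f = f.
  by move=> f hf; rewrite -{1}(hl' f hf) avK.
(* As [l] fixes [w], n(w) and mn(w) but moves m(w), the element m^-1 l m l^-1 fixes n(w) and moves
   [w]. *)
pose m2 := vmul (vinv m) (conj l m).
have hm2 : M m2 by apply: MM; [apply: MV|apply: MJ].
have e1 : av m2 (av n w) = av n w.
  by rewrite !av_mul lV /=; auto; rewrite hl' /=; auto; rewrite avK.
have e2 : av m2 w <> w.
  rewrite !av_mul lV /=; auto => h; apply: lw.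
  by rewrite -{2}h avKV.
apply: e2; apply: (@av_inj n); rewrite -av_mul -comm // av_mul e1 //.
Qed.

End PermutationGroups.

Lemma star_1 (Gam : group) (al : aut Gam) (g : Ggrp al) a x :
  a x = gone -> star al g a (ag g x) = gone.
Proof. by move=> h; rewrite starE h (hom1 (@coord_map_hom _ _ _ _)). Qed.

Lemma conj_star (Gam Gam' : group) (al : aut Gam) (al' : aut Gam')
    (th : giso (Ggrp al) (Ggrp al')) (g : Ggrp al) a :
  vmul (vmul (snd (th g)) (snd (th (kk al a)))) (vinv (snd (th g))) =
  snd (th (kk al (star al g a))).
Proof.
change (snd (th g ** th (kk al a) ** ginv (th g)) = snd (th (kk al (star al g a)))).
by rewrite -iso_hom star_mulE iso_hom gmulKr.
Qed.

(** [M] and [N] are the images in V of the elements of K supported on and off the cone 0. They are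
    exchanged by the image of the swap [sg] of the cones 0 and 1. *)
Lemma kernel_preserved (Gam Gam' : group) (al : aut Gam) (al' : aut Gam')
    (th : giso (Ggrp al) (Ggrp al')) a : snd (th (kk al a)) = vone.
Proof.
pose A (x : Q2) := is_prefix [false] (qw x).
pose p b := snd (th (kk al b)).
pose L v := exists b, p b = v.
pose M v := exists b, (forall x, ~ A x -> b x = gone) /\ p b = v.
pose N v := exists b, (forall x, A x -> b x = gone) /\ p b = v.
have [sg hsg] := swap_ex (@disj_bool false [] []).
have hp : forall b c, vmul (p b) (p c) = p (fun x => b x ** c x).
  by move=> b c; rewrite /p -kk_mul iso_hom.
have hpV : forall b, vinv (p b) = p (fun x => ginv (b x)).
  move=> b; have -> : vinv (p b) = snd (ginv (th (kk al b))) by [].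
  rewrite -(homV _ (@iso_hom _ _ th)) /p; congr (snd (th _)).
  symmetry; apply: ginv_uniq; rewrite kk_mul -kk_one; congr kk.
  by extensionality x; rewrite gmulVr.
have hst : forall b c x, c x = gone -> star al (kk al b) c x = gone.
  by move=> b c x h; have := star_1 (kk al b) h; rewrite /ag av_one.
have hA : forall x, A (av sg x) <-> ~ A x.
  case: hsg => h1 [h2 _] x; split.
    move=> h hx; have := prefix_app [true] (shift 1 (qw x)).
    rewrite -h1 (app_shift hx) => h'; exact: (@disj_bool false [] [] _ h h').
  move=> hx; suff h : is_prefix [true] (qw x).
    by rewrite /A /= -(app_shift h) h2; apply: prefix_app.
  case=> [|i] /=; last by lia.
  move=> _; case e : (qw x 0) => //; case: hx; case=> [|i] /=; first by rewrite e.
  lia.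
suff h : forall l, L l -> l = vone by apply: h; exists a.
apply: (@commuting_normal_factors L M N (snd (th (vv al sg)))).
- by move=> _ _ [b <-] [c <-]; rewrite hp; eexists.
- by move=> _ [b <-]; rewrite hpV; eexists.
(* Normality in all of V uses surjectivity of [th]: [v] is the V-component of the image of some
   element. *)
- move=> v _ [b <-]; rewrite -[v](f_equal snd (iso_funK th (vv al' v))) conj_star.
  by eexists.
- move=> _ _ [b [hb <-]] [c [hc <-]]; rewrite hp; eexists; split; last by [].
  by move=> x hx /=; rewrite hb // hc // gmul1l.
- move=> _ [b [hb <-]]; rewrite hpV; eexists; split; last by [].
  by move=> x hx /=; rewrite hb // ginv1.
- move=> _ _ [b <-] [c [hc <-]]; rewrite conj_star; eexists; split; last by [].
  by move=> x hx; apply: hst; apply: hc.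
- move=> _ _ [b <-] [c [hc <-]]; rewrite conj_star; eexists; split; last by [].
  by move=> x hx; apply: hst; apply: hc.
- move=> _ _ [b [hb <-]] [c [hc <-]]; rewrite !hp; congr p; extensionality x.
  by case: (classic (A x)) => hx; [rewrite (hc x hx)|rewrite (hb x hx)];
    rewrite gmul1l gmul1r.
- move=> _ [b <-].
  exists (p (fun x => if excluded_middle_informative (A x) is left _ then b x else gone)).
  exists (p (fun x => if excluded_middle_informative (A x) is left _ then gone else b x)).
  split; [|split]; last first.
  + rewrite hp; congr p; extensionality x.
    by case: excluded_middle_informative => _; rewrite ?gmul1l ?gmul1r.
  + by eexists; split; last reflexivity; move=> x hx /=; case: excluded_middle_informative.
  + by eexists; split; last reflexivity; move=> x hx /=; case: excluded_middle_informative.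
- move=> _ [b [hb <-]]; rewrite conj_star; eexists; split; last by [].
  move=> x; rewrite -(avKV sg x) hA => hx; apply: (star_1 (vv al sg)); exact: hb.
- move=> _ [b [hb <-]]; rewrite conj_star; eexists; split; last by [].
  move=> x; rewrite -(avKV sg x) hA => hx; apply: (star_1 (vv al sg)).
  apply: hb; exact: NNPP.
Qed.

(** * Isomorphisms act coordinatewise on K *)

Section Isomorphism.

Context (Gam Gam' : group) (al : aut Gam) (al' : aut Gam').
Context (th : giso (Ggrp al) (Ggrp al')).

Definition kmap (a : Q2 -> Gam) : Q2 -> Gam' := fst (th (kk al a)).

Lemma thK a : th (kk al a) = kk al' (kmap a).
Proof.
have := kernel_preserved th a; rewrite /kmap /kk; case: (th _) => b v /= -> //.
Qed.

Lemma kmap_mul a b x : kmap (fun x => a x ** b x) x = kmap a x ** kmap b x.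
Proof.
suff -> : kmap (fun x => a x ** b x) = fun x => kmap a x ** kmap b x by [].
by apply: (@kk_inj _ al'); rewrite -thK -kk_mul iso_hom !thK kk_mul.
Qed.

Lemma kmap_one : kmap (fun _ => gone) = fun _ => gone.
Proof.
by apply: (@kk_inj _ al'); rewrite -thK !kk_one; apply: (hom1 (@iso_hom _ _ th)).
Qed.

Lemma kmap_inj a b : kmap a = kmap b -> a = b.
Proof. by move=> h; apply: (@kk_inj _ al); apply: (giso_inj (f := th)); rewrite !thK h. Qed.

Lemma kmap_star (g : Ggrp al) a : kmap (star al g a) = star al' (th g) (kmap a).
Proof. by apply: star_uniq; rewrite -!thK -!iso_hom star_mulE. Qed.

Definition act (v : Vcar) (y : Q2) : Q2 := ag (th (vv al v)) y.

Lemma act_mul v w y : act (vmul v w) y = act v (act w y).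
Proof. by rewrite /act -ag_mul -iso_hom vv_mul. Qed.

Lemma act_inj v x y : act v x = act v y -> x = y.
Proof. exact: av_inj. Qed.

Lemma act_one y : act vone y = y.
Proof. by apply: (@act_inj vone); rewrite -act_mul; congr act; apply: vext. Qed.

(** [th] sends K into K', which acts trivially on Q_2, so the K-component of [g] does not matter. *)
Lemma ag_th (g : Ggrp al) y : ag (th g) y = act (snd g) y.
Proof.
by rewrite -{1}(kk_vv g) iso_hom ag_mul thK /ag /= av_one.
Qed.

Lemma act_trans x y : exists v, act v x = y.
Proof.
have [w hw] : exists w, av w x = y.
  case: (classic (x = y)) => h; first by exists vone; rewrite av_one.
  by have [t [ht _]] := @high_trans _ _ [] h ltac:(auto) ltac:(auto); exists t.
exists (snd (iso_inv th (vv al' w))).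
by rewrite -ag_th iso_funK.
Qed.

End Isomorphism.

Lemma kmap_symK (Gam Gam' : group) (al : aut Gam) (al' : aut Gam')
    (th : giso (Ggrp al) (Ggrp al')) a : kmap (giso_sym th) (kmap th a) = a.
Proof.
by apply: (@kk_inj _ al); rewrite -thK -thK /= iso_invK.
Qed.

Lemma kmap_symKV (Gam Gam' : group) (al : aut Gam) (al' : aut Gam')
    (th : giso (Ggrp al) (Ggrp al')) a : kmap th (kmap (giso_sym th) a) = a.
Proof.
by apply: (@kk_inj _ al'); rewrite -thK -thK /= iso_funK.
Qed.

(** * Germs at a point and the fixed points of their images *)

Section Points.

Context (Gam Gam' : group) (al : aut Gam) (al' : aut Gam').
Context (th : giso (Ggrp al) (Ggrp al')).

(* K splits as the product of its elements supported off and on the cone [u],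
   fixed by [b] and by [a] respectively.  Hence the values of any element
   of K' at the four points y, ay, by, aby would satisfy a relation, although
   they can be prescribed freely as soon as aby differs from the other three. *)
Lemma four_points (u : list bool) (a b : Vcar) (c : Gam') (y : Q2) : c <> gone ->
  (forall z, is_prefix u z -> vfun a z = z) ->
  (forall z, ~ is_prefix u z -> vfun b z = z) ->
  act th a y = y \/ act th b y = y \/ act th a (act th b y) = y.
Proof.
move=> hc ha hb; apply: NNPP => hn.
have [nay [nby naby]] : act th a y <> y /\ act th b y <> y /\ act th a (act th b y) <> y by tauto.
have hab : vmul a b = vmul b a.
  apply: vext => z /=; case: (classic (is_prefix u z)) => hz.
    rewrite (ha z hz); case: (classic (is_prefix u (vfun b z))) => h; first exact: ha.
    by have := hb _ h => /vinj hbz; rewrite hbz in h.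
  rewrite (hb z hz); case: (classic (is_prefix u (vfun a z))) => h; last by rewrite hb.
  by have := ha _ h => /vinj haz; rewrite haz in h.
(* The image of [e] is trivial except at aby. Below, [k] and [q] are the parts of [e] off and on the
   cone [u], so their images are mutually inverse at every other point. *)
pose e := kmap (giso_sym th) (delta (act th a (act th b y)) c).
have hFe : kmap th e = delta (act th a (act th b y)) c by apply: kmap_symKV.
pose A (x : Q2) := is_prefix u (qw x).
pose k x := if excluded_middle_informative (A x) is left _ then gone else e x.
pose q x := if excluded_middle_informative (A x) is left _ then e x else gone.
have hk : star al (vv al a) q = q.
  apply: star_fix => x; rewrite /q; case: excluded_middle_informative => // hx _.
  by exists u; split=> // z; apply: ha; apply: prefix_app.
have hq : star al (vv al b) k = k.
  apply: star_fix => x; rewrite /k; case: excluded_middle_informative => // hx _.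
  exact: nearid_supp hx.
have ekq : forall z, kmap th e z = kmap th k z ** kmap th q z.
  move=> z; rewrite -kmap_mul; congr kmap; extensionality x; rewrite /k /q.
  by case: excluded_middle_informative => _; rewrite ?gmul1l ?gmul1r.
have hinv : forall z, z <> act th a (act th b y) -> kmap th q z = ginv (kmap th k z).
  by move=> z hz; apply: ginv_uniq; rewrite -ekq hFe delta_ne.
have hK : kmap th k = star al' (th (vv al b)) (kmap th k) by rewrite -kmap_star hq.
have hQ : kmap th q = star al' (th (vv al a)) (kmap th q) by rewrite -kmap_star hk.
have hact : act th a (act th b y) = act th b (act th a y) by rewrite -!act_mul hab.
apply: hc; rewrite -(delta_eq (act th a (act th b y)) c) -hFe ekq.
set ta := th (vv al a) in hQ; set tb := th (vv al b) in hK.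
(* Both values at aby are traced back to that of [k] at y: for [k] through ay, for [q] through by.
   As ab = ba they cancel, forcing c = 1. *)
have ek : kmap th k (act th b (act th a y)) =
    star al' tb (star al' ta (kmap th k)) (act th b (act th a y)).
  rewrite {1}hK !starE; congr coord_map.
  rewrite -[LHS]ginvV -hinv; first by move=> h; apply: nby; apply: (@act_inj _ _ _ _ th a).
  rewrite hQ starE -(homV _ (@coord_map_hom _ _ _ _)); congr coord_map.
  by rewrite hinv ?ginvV; auto.
have eq : kmap th q (act th a (act th b y)) =
    ginv (star al' ta (star al' tb (kmap th k)) (act th a (act th b y))).
  rewrite {1}hQ !starE -(homV _ (@coord_map_hom _ _ _ _)); congr coord_map.
  by rewrite hinv; [rewrite hact => /act_inj h; case: nay|rewrite {1}hK starE].
rewrite {1}hact ek eq -hact -!star_mul -!iso_hom !vv_mul hab gmulVr.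
done.
Qed.

(** Apply [four_points] to [b] and to its square. If neither fixes y, then aby = y = abby, and
    cancelling ab gives by = y. *)
Lemma square_fixes (u : list bool) (a b : Vcar) (c : Gam') (y : Q2) : c <> gone ->
  (forall z, is_prefix u z -> vfun a z = z) -> act th a y <> y ->
  (forall z, ~ is_prefix u z -> vfun b z = z) ->
  act th (vmul b b) y = y.
Proof.
move=> hc ha hay hb.
have hbb : forall z, ~ is_prefix u z -> vfun (vmul b b) z = z.
  by move=> z hz /=; rewrite !hb.
case: (four_points y hc ha hb) => [//|[h|h1]].
  by rewrite act_mul !h.
case: (four_points y hc ha hbb) => [//|[//|]].
rewrite -[X in _ = X -> _]h1 act_mul => /act_inj /act_inj h; by rewrite !h.
Qed.

Lemma star_at_fixed (t : Vcar) (b : Q2 -> Gam') y :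
  act th t y = y -> star al' (th (vv al t)) b y = coord_map al' (th (vv al t)) y (b y).
Proof. by move=> h; rewrite -{1}h starE. Qed.

Definition central (G : group) (c : G) : Prop := forall d, d ** c = c ** d.

(** The image of an involution has slope 1 at a fixed point, so only an inner automorphism is left,
    and it fixes central elements. *)
Lemma involution_coord_map_central (t : Vcar) (c : Gam') y :
  vmul t t = vone -> act th t y = y -> central c -> coord_map al' (th (vv al t)) y c = c.
Proof.
move=> ht hy hc; rewrite /coord_map.
set w := snd (th (vv al t)).
have hw : vmul w w = vone.
  have -> : vmul w w = snd (th (vv al t) ** th (vv al t)) by [].
  rewrite -iso_hom vv_mul ht; have -> : vv al vone = gone by [].
  by rewrite (hom1 (@iso_hom _ _ th)).
have hs : sl w y = 0%Z.
  have := sl_mul w w y; have -> : av w y = y by exact: hy.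
  by rewrite hw sl_one; lia.
by rewrite hs /= /ad hc gmulKr.
Qed.

(** Elements supported on the cone are fixed by [a], so the value of their image at y is determined
    by the one at ay. Conjugating [r] by an element whose image is [d] at y and trivial at ay
    changes nothing at ay, hence nothing at y. *)
Lemma cone_central (u : list bool) (a : Vcar) (r : Q2 -> Gam) (y : Q2) :
  (forall z, is_prefix u z -> vfun a z = z) -> act th a y <> y ->
  (forall z, ~ is_prefix u (qw z) -> r z = gone) -> central (kmap th r y).
Proof.
move=> ha hay hr d.
have hfix : forall b : Q2 -> Gam, (forall z, ~ is_prefix u (qw z) -> b z = gone) ->
    star al (vv al a) b = b.
  move=> b hb; apply: star_fix => z hz; exists u; split.
    by apply: NNPP => h; apply: hz; apply: hb.
  by move=> x; apply: ha; apply: prefix_app.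
pose e := kmap (giso_sym th) (delta y d).
have he : kmap th e = delta y d by apply: kmap_symKV.
pose r' z := e z ** r z ** ginv (e z).
have hr' : forall z, ~ is_prefix u (qw z) -> r' z = gone.
  by move=> z hz; rewrite /r' hr // gmul1r gmulVr.
have hre : forall z, kmap th r' z ** kmap th e z = kmap th e z ** kmap th r z.
  move=> z; rewrite -!kmap_mul; congr kmap; extensionality x.
  by rewrite /r' gmulKVr.
have h1 := hre y; have h2 := hre (act th a y).
rewrite he delta_eq in h1; rewrite he delta_ne // gmul1l gmul1r in h2.
rewrite -h1; congr gmul; symmetry.
apply: (@coord_map_inj _ al' (th (vv al a)) y).
by rewrite -!starE -!kmap_star !hfix.
Qed.

Definition Rel (x y : Q2) : Prop := exists c, kmap th (delta x c) y <> gone.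

(* If [a] moved [y], then the image of K(cone of x) at [y] would be central
   and fixed by the transpositions in the cone.  Two of them multiply to an
   element [g] for which x has an infinite forward orbit, so that delta_x(c) is
   the "commutator" of [g] with an element supported on this orbit. *)
Lemma nearid_act (x y : Q2) (a : Vcar) : Rel x y -> nearid a x -> act th a y = y.
Proof.
move=> [c hc] [u [hu ha0]]; apply: NNPP => hay.
have ha : forall z, is_prefix u z -> vfun a z = z.
  by move=> z hz; rewrite -(app_shift hz).
have [n [hn hx]] := q2_split x (length u).
have [s hs] := prefix_split hu (prefix_take n (qw x)) ltac:(by rewrite length_take).
rewrite {}hs in hx; set p := u ++ s in hx.
have hpu : forall q, p ++ q = u ++ (s ++ q) by move=> q; rewrite /p -app_assoc.
clearbody p.
have d1 : disj (p ++ [false]) (p ++ [true]) by apply/disj_same/(@disj_bool false [] []).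
have d2 : disj (p ++ [false]) (p ++ [true; true]).
  by apply/disj_same/(@disj_bool false [] [true]).
have [t1 ht1] := swap_ex d1.
have [t2 ht2] := swap_ex d2.
(* Such a transposition is the square of an element supported in the cone [u], hence fixes y by
   [square_fixes]. *)
have swap_ok : forall q q' t, disj (p ++ q) (p ++ q') -> is_swap (p ++ q) (p ++ q') t ->
    act th t y = y /\ forall d, central d -> coord_map al' (th (vv al t)) y d = d.
  move=> q q' t hd ht.
  have hy : act th t y = y.
    have [b [<- hb]] := swap_sqrt hd ht.
    apply: (square_fixes hc ha hay) => z hz; apply: hb => h; apply: hz;
    move: h; rewrite hpu; exact: prefix_cat.
  split=> // d; apply: involution_coord_map_central => //.
  by apply: vext => z; apply: is_swap_inv ht.
have [hy1 hT1] := swap_ok _ _ _ d1 ht1.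
have [hy2 hT2] := swap_ok _ _ _ d2 ht2.
(* [t1] swaps p0 with p1, and [t2] swaps p0 with p11; so [g] sends the point p 1^i 000... to p
   1^(i+1) 000..., starting from x at i = 0. *)
pose g := vmul t2 t1.
pose e n := qapp (p ++ repeat true n).
have e0 : e 0 = x by apply: qinj; rewrite /= app_nil_r hx.
have einj : forall i j, e i = e j -> i = j.
  move=> i j /(f_equal qw) /=; rewrite !app_word_app => /app_word_injr h.
  apply: qpt_inj; exact: qinj.
have eS : forall i, av g (e i) = e (S i).
  move=> i; apply: qinj => /=; move: ht1 ht2 => [f1 [f2 f3]] [g1 [g2 g3]].
  case: i => [|i] /=.
    have hz : zeros = app_word [false] zeros.
      by extensionality k; case: k => [|k] //=; rewrite /app_word; case: Nat.ltb; case: k.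
    rewrite app_nil_r {1}hz -app_word_app f1.
    rewrite g3 // app_word_app => /prefix_cat_app; rewrite {1}hz.
      move=> h; have := h 0 => /=; rewrite /app_word /=; by move=> /(_ ltac:(lia)).
    move=> h; have := h 1 => /=; rewrite /app_word /=; by move=> /(_ ltac:(lia)).
  have -> : p ++ true :: repeat true i = (p ++ [true]) ++ repeat true i by rewrite -app_assoc.
  rewrite app_word_app f2 g1 -app_word_app; congr app_word.
  by rewrite -app_assoc.
(* The value [c] at x is transported along the orbit by [g], which makes [r] the product of
   delta_x(c) and its own transform under [g]. *)
pose val := nat_rect (fun _ => gcar Gam) c (fun i d => coord_map al (vv al g) (e i) d).
pose r z := if excluded_middle_informative (exists i, z = e i) is left H
  then val (proj1_sig (constructive_indefinite_description _ H)) else gone.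
have re : forall i, r (e i) = val i.
  move=> i; rewrite /r; case: excluded_middle_informative => [H|[]]; last by exists i.
  by case: constructive_indefinite_description => j /= /einj ->.
have rn : forall z, (forall i, z <> e i) -> r z = gone.
  by move=> z hz; rewrite /r; case: excluded_middle_informative => // [[i hi]]; case: (hz i).
have hr : r = fun z => delta x c z ** star al (vv al g) r z.
  extensionality z; have [z' hz'] := ag_surj (vv al g) z.
  rewrite -{3}hz' starE.
  case: (classic (exists i, z' = e i)) => [[i hi]|hi].
    have -> : z = e (S i) by rewrite -eS -hi -hz'.
    rewrite re hi re delta_ne ?gmul1l // -e0 => /einj; lia.
  rewrite (rn z') ?(hom1 (@coord_map_hom _ _ _ _)) ?gmul1r; first by move=> i h; apply: hi; exists i.
  case: (classic (z = x)) => [->|hzx]; first by rewrite delta_eq -e0 re.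
  rewrite delta_ne // rn // => [[|i] h]; first by apply: hzx; rewrite h e0.
  apply: hi; exists i; apply: (@av_inj g); rewrite eS -h; exact: hz'.
have hcen : central (kmap th r y).
  apply: (cone_central ha hay) => z hz; apply: rn => i h; apply: hz; rewrite h /=.
  rewrite hpu app_word_app; exact: prefix_app.
apply: hc; apply: (@gmulIr _ (kmap th r y)); rewrite gmul1l.
rewrite [in RHS]hr kmap_mul; congr gmul.
have -> : vv al g = vv al t2 ** vv al t1 by rewrite vv_mul.
by rewrite star_mul !kmap_star !star_at_fixed // hT1 // hT2.
Qed.

End Points.

(** * The induced bijection of the dyadic rationals *)

Section Bijection.

Context (Gam Gam' : group) (al : aut Gam) (al' : aut Gam').
Context (th : giso (Ggrp al) (Ggrp al')).

Lemma Rel_ag (g : Ggrp al) x y : Rel th x y -> Rel th (ag g x) (ag (th g) y).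
Proof.
move=> [c hc]; exists (coord_map al g x c); rewrite -star_delta kmap_star starE => h.
apply: hc; apply: (@coord_map_inj _ al' (th g) y); by rewrite h (hom1 (@coord_map_hom _ _ _ _)).
Qed.

Lemma Rel_act v x y : Rel th x y -> Rel th (av v x) (act th v y).
Proof. exact: (@Rel_ag (vv al v)). Qed.

(** If x' differs from x, moving it by elements trivial near x, which fix y, relates every point to
    y. Then every element of V fixes y, contradicting transitivity. *)
Lemma Rel_fun x x' y : Rel th x y -> Rel th x' y -> x = x'.
Proof.
move=> hx hx'; apply: NNPP => hne.
have hall : forall z, Rel th z y.
  move=> z; case: (classic (z = x)) => [->//|hzx].
  case: (classic (x' = z)) => [<-//|hzx'].
  have [t [<- ht]] := @high_trans x' z [x] hzx'
    ltac:(case=> //; auto) ltac:(case=> //; auto).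
  rewrite -(nearid_act hx (ht x ltac:(by left))); exact: Rel_act.
have hfix : forall v, act th v y = y.
  move=> v; case: (classic (v = vone)) => [->|/V_moves [z hz]]; first exact: act_one.
  have [x3 hx3] := fresh [z; av v z].
  have [N1 hN1] := @separate z [x3] ltac:(case=> // h; apply: hx3; left; auto).
  have [N2 hN2] := @separate (av v z) [x3] ltac:(case=> // h; apply: hx3; right; left; auto).
  have [i hi] : exists i, qw z i <> qw (av v z) i by apply: cantor_neq => /qinj e; case: hz.
  (* The depth makes the cones [u] and [w] disjoint and keeps [x3] out of both. Their swap [t] is
     then trivial near [x3], and tv is trivial near [z]. *)
  have [u [w [hu [hlu [hlw h]]]]] := vlocal v (qw z) (N1 + N2 + S i).
  have hw : is_prefix w (qw (av v z)) by rewrite /= -(app_shift hu) h; apply: prefix_app.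
  have hd : disj u w.
    rewrite (prefix_eq_take hu) (prefix_eq_take hw); apply: (@disj_take _ _ i) => //; lia.
  have [t ht] := swap_ex hd.
  have h1 : act th t y = y.
    apply: (nearid_act (hall x3)); apply: (swap_nearid _ ht).
      rewrite (prefix_eq_take hu); apply: hN1; [lia|by left].
    rewrite (prefix_eq_take hw); apply: hN2; [lia|by left].
  have h2 : act th (vmul t v) y = y.
    apply: (nearid_act (hall z)); exists u; split=> // z0 /=.
    by rewrite h; case: ht => _ [].
  by apply: (@act_inj _ _ _ _ th t); rewrite -act_mul h2 h1.
have [q hq] := fresh [y].
have [v hv] := act_trans th y q.
by apply: hq; left; rewrite -hv hfix.
Qed.

Lemma Rel_nontrivial x y : Rel th x y -> exists c : Gam, c <> gone.
Proof.
move=> [c hc]; exists c => e; apply: hc; rewrite e.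
have -> : delta x (@gone Gam) = fun _ => gone.
  by extensionality z; rewrite /delta; case: excluded_middle_informative.
by rewrite kmap_one.
Qed.

Lemma Rel_total (c : Gam) x : c <> gone -> exists y, Rel th x y.
Proof.
move=> hc; apply: NNPP => h; apply: hc.
rewrite -(delta_eq x c).
suff -> : delta x c = fun _ => gone by [].
apply: (@kmap_inj _ _ _ _ th); rewrite kmap_one; extensionality y.
by apply: NNPP => hy; apply: h; exists y, c.
Qed.

Lemma Rel_surj (c : Gam) y : c <> gone -> exists x, Rel th x y.
Proof.
move=> hc; have [y0 h0] := Rel_total (qapp []) hc.
have [v <-] := act_trans th y0 y.
by eexists; apply: Rel_act h0.
Qed.

End Bijection.

Section Bijection2.

Context (Gam Gam' : group) (al : aut Gam) (al' : aut Gam').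
Context (th : giso (Ggrp al) (Ggrp al')).

Notation th' := (giso_sym th).

Lemma Rel_sym_act v x y : Rel th' y x -> Rel th' (act th v y) (av v x).
Proof.
move=> /(@Rel_ag _ _ _ _ th' (th (vv al v))) /=.
by rewrite iso_invK.
Qed.

(** Let th^-1 relate y to x'. If x' is not x, take [t] moving x and fixing x': uniqueness for th^-1
    shows that [t] fixes y, and then uniqueness for th that it fixes x. *)
Lemma Rel_sym x y : Rel th x y -> Rel th' y x.
Proof.
move=> h; have [c hc] := h.
have [x' hx'] := Rel_total th' y hc.
case: (classic (x = x')) => [->//|hne].
have [q hq] := fresh [x; x'].
have hxq : x <> q by move=> e; apply: hq; left.
have nx : ~ In x [x'] by case=> // e; apply: hne.
have nq : ~ In q [x'] by case=> // e; apply: hq; right; left.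
have [t [htx htx']] := high_trans _ hxq nx nq.
have e' : av t x' = x' by apply/nearid_fix/htx'; left.
have hy : act th t y = y.
  have := Rel_sym_act t hx'; rewrite e' => h1; exact: Rel_fun h1 hx'.
have := Rel_act t h; rewrite htx hy => h2.
by case: hxq; apply: Rel_fun h h2.
Qed.

End Bijection2.

Lemma Rel_inj (Gam Gam' : group) (al : aut Gam) (al' : aut Gam')
  (th : giso (Ggrp al) (Ggrp al')) x y y' : Rel th x y -> Rel th x y' -> y = y'.
Proof. move=> /Rel_sym h /Rel_sym; exact: Rel_fun h. Qed.

(** * Continuity of the bijection and preservation of slopes *)

Lemma zeros_repeat n : zeros = app_word (repeat false n) zeros.
Proof.
extensionality i; case: (Nat.lt_ge_cases i (length (repeat false n))) => h.
  by rewrite app_word_lt // nth_repeat.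
rewrite (_ : i = length (repeat false n) + (i - length (repeat false n))); first lia.
by rewrite app_word_ge.
Qed.

Section Continuity.

Context (Gam Gam' : group) (al : aut Gam) (al' : aut Gam').
Context (th : giso (Ggrp al) (Ggrp al')).

(* An element supported in the cone [u] and moving [x] is sent to one moving
   every point of a neighbourhood of [y]. *)
Lemma Rel_continuous x y u : Rel th x y -> is_prefix u (qw x) ->
  exists n, forall x' y', Rel th x' y' -> is_prefix (take n (qw y)) (qw y') ->
    is_prefix u (qw x').
Proof.
move=> h hu.
have [t [htx ht]] : exists t, av t x <> x /\ forall z, ~ is_prefix u z -> vfun t z = z.
  have [N hN] := q2_tail x; set n := N + length u.
  have hx := hN n ltac:(lia).
  have [t [h1 [h2 h3]]] := swap_ex (@disj_same (take n (qw x)) _ _ (@disj_bool false [] [])).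
  exists t; split.
    move=> /(f_equal qw) /=.
    rewrite hx {1}(zeros_repeat 1) /= -app_word_app h1 app_word_app => /app_word_injr e.
    by have := f_equal (fun f => f 0) e.
  have [s hs] := prefix_split hu (prefix_take n (qw x)) ltac:(rewrite length_take; lia).
  move=> z hz; apply: h3; rewrite hs -app_assoc => /prefix_cat //.
have hty : act th t y <> y.
  by move=> e; apply: htx; have := Rel_act t h; rewrite e => h'; apply: Rel_fun h' h.
set w := snd (th (vv al t)).
have hwy : av w y <> y by [].
have [i hi] : exists i, qw (av w y) i <> qw y i by apply: cantor_neq => /qinj.
(* Both words reach past the digit [i] where y and its image differ, so every point of the cone [p]
   is moved. *)
have [p [q [hp [hlp [hlq hpq]]]]] := vlocal w (qw y) (S i).
exists (length p) => x' y' hR; rewrite -(prefix_eq_take hp) => hy'.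
apply: NNPP => hx'.
have e : av t x' = x' by apply: qinj; apply: ht.
have hy'' : act th t y' = y'.
  by have := Rel_act t hR; rewrite e => hR'; apply: Rel_inj hR' hR.
apply: hi.
have -> : qw y i = qw y' i by rewrite -hp -?hy' //; lia.
rewrite -hy'' [in RHS]/act /= -/w -(app_shift hp) -(app_shift hy') !hpq.
by rewrite !app_word_lt //; lia.
Qed.

Definition thV (v : Vcar) : Vcar := snd (th (vv al v)).

Lemma thV_mul v w : thV (vmul v w) = vmul (thV v) (thV w).
Proof. by rewrite /thV -vv_mul iso_hom. Qed.

Lemma thV_one : thV vone = vone.
Proof.
have -> : thV vone = snd (th gone) by [].
by rewrite (hom1 (@iso_hom _ _ th)).
Qed.

Lemma thV_surj w : exists v, thV v = w.
Proof.
exists (snd (iso_inv th (vv al' w))).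
set g := iso_inv th _.
have : snd (th g) = w by rewrite /g iso_funK.
rewrite -{1}(kk_vv g) iso_hom thK /= => <-; symmetry; exact: (gmul1l Vgrp).
Qed.

Lemma Rel_stab x y v : Rel th x y -> (av v x = x <-> av (thV v) y = y).
Proof.
move=> h; have h' := Rel_act v h; split=> e.
  by rewrite e in h'; apply: Rel_inj h' h.
have e' : act th v y = y by exact: e.
by rewrite e' in h'; apply: Rel_fun h' h.
Qed.

(** By continuity the points of Q_2 near y correspond to points of the cone [u], which [v] fixes; so
    [thV v] fixes them, and its source and target words at y agree. *)
Lemma nearid_slope x y v : Rel th x y -> nearid v x -> sl (thV v) y = 0%Z.
Proof.
move=> h [u [hu hv]]; have [c hc] := Rel_nontrivial h.
have [n hn] := Rel_continuous h hu.
have [p [q [hp [hlp [_ hpq]]]]] := vlocal (thV v) (qw y) n.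
suff e : p = q by rewrite (sl_eq _ _ hp hpq) e; lia.
apply: app_word_determined => z hz; rewrite -hpq.
have hpz := proj1 (ev0_app p z) hz.
pose y' : Q2 := exist _ (app_word p z) hpz.
have [x' hx'] := Rel_surj th y' hc.
have hx'u : is_prefix u (qw x').
  apply: hn hx' _; have [s hs] := prefix_split (prefix_take n (qw y)) hp
     ltac:(by rewrite length_take).
  rewrite /= hs app_word_app; exact: prefix_app.
have e : av v x' = x' by apply: qinj; rewrite /= -(app_shift hx'u) hv.
have /(f_equal qw) /= := proj1 (Rel_stab v hx') e; by [].
Qed.

Definition vpow (v : Vcar) (n : nat) : Vcar := Nat.iter n (vmul v) vone.

Lemma vpow_fix v n x : av v x = x -> av (vpow v n) x = x.
Proof. by move=> h; elim: n => [|n IH] /=; rewrite ?av_one // av_mul IH. Qed.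

Lemma sl_pow v n x : av v x = x -> sl (vpow v n) x = (Z.of_nat n * sl v x)%Z.
Proof.
move=> h; elim: n => [|n IH]; first by rewrite sl_one.
change (sl (vmul v (vpow v n)) x = (Z.of_nat (S n) * sl v x)%Z).
rewrite sl_mul vpow_fix // IH; lia.
Qed.

Lemma thV_pow v n : thV (vpow v n) = vpow (thV v) n.
Proof. by elim: n => [|n IH] /=; rewrite ?thV_one // thV_mul IH. Qed.

Lemma sl_inv v x : av v x = x -> sl (vinv v) x = (- sl v x)%Z.
Proof.
move=> h; have := sl_mul (vinv v) v x.
have -> : vmul (vinv v) v = vone by exact: (gmulVl Vgrp).
rewrite h sl_one; lia.
Qed.

Lemma thV_inv v : thV (vinv v) = vinv (thV v).
Proof.
apply: (@ginv_uniq Vgrp (thV v)).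
change (vmul (thV v) (thV (vinv v)) = vone).
rewrite -thV_mul -thV_one; congr thV; exact: (@gmulVr Vgrp v).
Qed.

End Continuity.

Definition contracts (v : Vcar) (x : Q2) : Prop := exists u,
  qw x = app_word u zeros /\ forall z, vfun v (app_word u z) = app_word (u ++ [false]) z.

Lemma contracts_ex x : exists v, contracts v x.
Proof.
(* Depth [S N] makes the word nonempty, which leaves a disjoint cone through which the two swaps
   pass. *)
have [N hN] := q2_tail x; have hx := hN (S N) ltac:(lia).
move: (length_take (S N) (qw x)); move: (take _ _) hx => [//|b u] hx _.
have d1 : disj (b :: u) [negb b] by exact: disj_bool.
have d2 : disj ((b :: u) ++ [false]) [negb b] by exact: (@disj_bool b (u ++ [false]) []).
have [t1 [h1 _]] := swap_ex d1.
have [t2 [_ [h2 _]]] := swap_ex d2.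
by exists (vmul t2 t1), (b :: u); split=> // z /=; rewrite h1 h2.
Qed.

Lemma contracts_fix v x : contracts v x -> av v x = x.
Proof.
move=> [u [hx hv]]; apply: qinj; rewrite /= hx hv app_word_app.
by rewrite [in RHS](zeros_repeat 1).
Qed.

Lemma contracts_sl v x : contracts v x -> sl v x = (-1)%Z.
Proof.
move=> [u [hx hv]]; rewrite (@sl_eq v x u _ _ hv) ?length_app /=; last lia.
by rewrite hx; apply: prefix_app.
Qed.

Section Slopes.

Context (Gam Gam' : group) (al : aut Gam) (al' : aut Gam').
Context (th : giso (Ggrp al) (Ggrp al')).

(* Points near [x] stay near [x] under [v], so their images stay near [y] under
   [thV v]; but an expanding map pushes every point other than [y] away. *)
Lemma contracts_not_expanding x y v : Rel th x y -> contracts v x ->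
  sl (thV th v) y <> 1%Z.
Proof.
move=> h hv hs; set w := thV th v in hs.
have hwy : av w y = y by apply/(Rel_stab v h)/contracts_fix.
have [c hc] := Rel_nontrivial h.
have [N hN] := q2_tail y.
have [p [q [hp [hlp [hlq hpq]]]]] := vlocal w (qw y) N.
have hq : is_prefix q (qw y) by rewrite -hwy /= -(app_shift hp) hpq; apply: prefix_app.
have hyq : qw y = app_word q zeros by rewrite {1}(hN (length q) hlq) -(prefix_eq_take hq).
have ep : p = q ++ [false].
  have hl : length p = length (q ++ [false]).
    move: hs; rewrite (sl_eq _ _ hp hpq) length_app /=; lia.
  rewrite (prefix_eq_take hp) hl -(@prefix_eq_take (q ++ [false])) //.
  by rewrite hyq {1}(zeros_repeat 1) /= -app_word_app; apply: prefix_app.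
subst p.
have [n hn] := Rel_continuous (Rel_sym h) hq.
have [u [hx hvu]] := hv.
(* A forward orbit of [v] that stays within the first [n] digits of x and never reaches x. *)
pose e m := qapp (u ++ repeat false (n + m) ++ [true]).
have eS : forall m, av v (e m) = e (S m).
  move=> m; apply: qinj; rewrite /= (app_word_app u) hvu -app_word_app.
  by rewrite Nat.add_succ_r /= -app_assoc.
have en : forall m, is_prefix (take n (qw x)) (qw (e m)).
  move=> m; apply/prefix_take_iff => i hi.
  rewrite hx (zeros_repeat (n + m)) -app_word_app /= app_assoc app_word_app.
  have hl : i < length (u ++ repeat false (n + m)) by rewrite length_app repeat_length; lia.
  by rewrite !(app_word_lt _ _ hl).
have [z0 hz0] := Rel_total th (e 0) hc.
pose z m := Nat.iter m (act th v) z0.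
have hz : forall m, Rel th (e m) (z m).
  by elim=> [//|m IH] /=; rewrite -eS; apply: Rel_act.
have hzS : forall m, qw (z (S m)) = vfun w (qw (z m)) by [].
have hzq : forall m, is_prefix q (qw (z m)).
  by move=> m; apply: hn (Rel_sym (hz m)) (en m).
(* [w] strips a zero after [q] and is injective, so from z(m+1) in the cone q 0^i one gets z(m) in q
   0^(i+1). Hence all z(m) equal y. *)
have hzi : forall i m, is_prefix (q ++ repeat false i) (qw (z m)).
  elim=> [|i IH] m; first by rewrite app_nil_r.
  have := IH (S m) => h1; have := app_shift h1.
  set s := shift _ _; rewrite hzS app_word_app -hpq => /vinj <-.
  have -> : q ++ repeat false (S i) = (q ++ [false]) ++ repeat false i by rewrite -app_assoc.
  rewrite -app_word_app; exact: prefix_app.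
have ez : z 0 = y.
  apply: qinj; extensionality k.
  have hl : k < length (q ++ repeat false (S k)) by rewrite length_app repeat_length; lia.
  rewrite -(hzi (S k) 0) // hyq (zeros_repeat (S k)) -app_word_app app_word_lt //.
have := hz 0; rewrite ez => h0.
have /(f_equal qw) := Rel_fun h0 h.
rewrite /= hx app_word_app => /app_word_injr e1.
have := f_equal (fun f => f (length (repeat false (n + 0)) + 0)) e1.
by rewrite app_word_app app_word_ge.
Qed.

(** Pick [s] whose image contracts at y. A power of [v] times [s] or its inverse has trivial germ at
    x, so by [nearid_slope] a multiple of the slope exponent of [thV th v] is 1 or -1. That exponent
    is thus 1 or -1, and 1 is excluded. *)
Lemma contracts_slope x y v : Rel th x y -> contracts v x -> sl (thV th v) y = (-1)%Z.
Proof.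
move=> h hv; have hexp := contracts_not_expanding h hv.
have hvx := contracts_fix hv; have hvs := contracts_sl hv.
have hwy : av (thV th v) y = y by apply/(Rel_stab v h).
have [vt hvt] := contracts_ex y.
have [s hs] := thV_surj th vt.
have hvty := contracts_fix hvt; have hvts := contracts_sl hvt.
have hsx : av s x = x by apply/(Rel_stab s h); rewrite hs.
case: (Z.le_ge_cases (sl s x) 0) => hj.
  pose n := Z.to_nat (- sl s x).
  have hnear : nearid (vmul (vinv s) (vpow v n)) x.
    apply: sl0_nearid; first by rewrite av_mul vpow_fix // -{1}hsx avK.
    by rewrite sl_mul vpow_fix // sl_inv // sl_pow // hvs /n; lia.
  have := nearid_slope h hnear.
  rewrite thV_mul thV_pow thV_inv hs sl_mul vpow_fix // sl_pow // sl_inv // hvts.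
  move: (Z.of_nat n) (Nat2Z.is_nonneg n) (sl _ _) => m hm k e.
  have := @Z.mul_eq_1 m (- k)%Z; rewrite Z.mul_opp_r => /(_ ltac:(lia)) [] em; subst m; lia.
pose n := Z.to_nat (sl s x).
have hnear : nearid (vmul s (vpow v n)) x.
  apply: sl0_nearid; first by rewrite av_mul vpow_fix.
  by rewrite sl_mul vpow_fix // sl_pow // hvs /n; lia.
have := nearid_slope h hnear.
rewrite thV_mul thV_pow hs sl_mul vpow_fix // sl_pow // hvts.
move: hexp; move: (Z.of_nat n) (Nat2Z.is_nonneg n) (sl _ _) => m hm k hexp e.
have := @Z.mul_eq_1 m k ltac:(lia) => [] [] em; subst m; lia.
Qed.

Lemma kmap_delta x y c : Rel th x y -> kmap th (delta x c) = delta y (kmap th (delta x c) y).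
Proof.
move=> h; extensionality z; case: (classic (z = y)) => [->|hz]; first by rewrite delta_eq.
rewrite delta_ne //; apply: NNPP => hc; apply: hz.
by apply: Rel_inj h; exists c.
Qed.

End Slopes.

(** * The conjugacy read off from a contracting germ *)

Lemma delta_mul (Gam : group) x (c d : Gam) :
  delta x (c ** d) = fun z => delta x c z ** delta x d z.
Proof.
extensionality z; rewrite /delta; case: excluded_middle_informative => // _.
by rewrite gmul1l.
Qed.

Lemma conjugate_of_giso (Gam Gam' : group) (al : aut Gam) (al' : aut Gam')
    (th : giso (Ggrp al) (Ggrp al')) :
  exists (be : giso Gam Gam') (h : Gam'),
    forall y : Gam', al' y = ad h (be (al (iso_inv be y))).
Proof.
case: (classic (exists c : Gam, c <> gone)) => [[c0 hc0]|htriv]; last first.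
  have h1 : forall c : Gam, c = gone by move=> c; apply: NNPP => h; apply: htriv; exists c.
  have h2 : forall c : Gam', c = gone.
    move=> c; rewrite -(delta_eq (qapp []) c) -(kmap_symKV th (delta _ c)).
    have -> : kmap (giso_sym th) (delta (qapp []) c) = fun _ => gone.
      by extensionality z.
    by rewrite kmap_one.
  have hh : is_hom Gam Gam' (fun _ => gone) by move=> x y; rewrite gmul1l.
  exists (@GIso Gam Gam' (fun _ => gone) (fun _ => gone) hh
    (fun x => eq_sym (h1 x)) (fun y => eq_sym (h2 y))), gone => y.
  by rewrite (h2 (al' y)) [RHS]h2.
pose x := qapp []; have [y hR] := Rel_total th x hc0.
have [v hv] := contracts_ex x.
have hR' := Rel_sym hR.
pose be c := kmap th (delta x c) y.
pose bi c := kmap (giso_sym th) (delta y c) x.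
have hbe : is_hom _ _ be.
  by move=> c d; rewrite /be delta_mul kmap_mul.
have h1 : forall c, bi (be c) = c.
  by move=> c; rewrite /bi /be -(kmap_delta c hR) kmap_symK delta_eq.
have h2 : forall c, be (bi c) = c.
  by move=> c; rewrite /bi /be -(kmap_delta c hR') kmap_symKV delta_eq.
have hvy : act th v y = y by apply/(Rel_stab v hR)/contracts_fix.
exists (@GIso Gam Gam' be bi hbe h1 h2), (ginv (fst (th (vv al v)) y)) => d /=.
(* Exponent -1 on both sides makes [v] act on the coordinate x by [al], and its image on the
   coordinate y by [al'] followed by conjugation by its K'-component at y. *)
have key : be (al (bi d)) = ad (fst (th (vv al v)) y) (al' d).
  rewrite {1}/be.
  have -> : delta x (al (bi d)) = star al (vv al v) (delta x (bi d)).
    rewrite star_delta coord_map_vv (contracts_sl hv) /ag /= (contracts_fix hv).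
    done.
  rewrite kmap_star star_at_fixed // /coord_map.
  have -> : sl (snd (th (vv al v))) y = (-1)%Z by apply: contracts_slope hR hv.
  have -> : ag (th (vv al v)) y = y by exact: hvy.
  by rewrite -/(be _) h2.
by rewrite key -adM gmulVl ad1.
Qed.

(** * Comparison with the partial encoding of G(alpha) *)

Definition toV (f : cantor -> cantor) (hf : isV f) : Vcar := exist _ f hf.

Lemma preim_av (v : Vcar) x : preim (vfun v) (av v x) = x.
Proof.
rewrite /preim; case: excluded_middle_informative => [H|[]]; last by exists x.
case: constructive_indefinite_description => y /= hy.
by apply: qinj; apply: (@vinj v).
Qed.

Lemma rho_av (Gam : group) (al : aut Gam) (v : Vcar) a x :
  rho al (vfun v) a (av v x) = aut_pow al (- sl v x) (a x).
Proof. by rewrite /rho preim_av. Qed.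

Definition emb (Gam : group) (g : Gc Gam) : Gcar Gam := (fst g, vfun (snd g)).

Lemma emb_inG (Gam : group) (g : Gc Gam) : inG (emb g).
Proof. exact: proj2_sig (snd g). Qed.

Lemma emb_inj (Gam : group) (g h : Gc Gam) : emb g = emb h -> g = h.
Proof. by case: g h => a v [b w] [-> /sig_inj ->]. Qed.

Lemma emb_mul (Gam : group) (al : aut Gam) (g h : Ggrp al) :
  emb (g ** h) = Gmul al (emb g) (emb h).
Proof.
rewrite /Gmul /emb /=; congr pair; extensionality x; congr gmul.
by rewrite -(avKV (snd g) x) actr_av rho_av.
Qed.

Lemma emb_surj (Gam : group) (k : Gcar Gam) : inG k -> exists g : Gc Gam, emb g = k.
Proof. by case: k => a f hf; exists (a, toV hf). Qed.

Lemma giso_of_G_isomorphic (Gam Gam' : group) (al : aut Gam) (al' : aut Gam') :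
  G_isomorphic al al' -> inhabited (giso (Ggrp al) (Ggrp al')).
Proof.
move=> [phi [hG [hi [hs hm]]]].
pose f (g : Ggrp al) : Ggrp al' := (fst (phi (emb g)), toV (hG _ (emb_inG g))).
have hf : forall g, emb (f g) = phi (emb g).
  by move=> g; rewrite /f /emb /=; case: (phi _).
suff [F _] : exists F : giso (Ggrp al) (Ggrp al'), forall x, F x = f x by constructor.
apply: giso_of_bij.
- move=> g h; apply: emb_inj.
  by rewrite emb_mul !hf emb_mul hm //; apply: emb_inG.
- move=> g h e; apply: emb_inj; apply: hi; try exact: emb_inG.
  by rewrite -!hf e.
- move=> k; have [g0 [hg0 e]] := hs _ (emb_inG k).
  have [g eg] := emb_surj hg0; exists g; apply: emb_inj.
  by rewrite hf eg e.
Qed.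

(** * The isomorphism attached to a conjugacy *)

Section Converse.

Context (Gam Gam' : group) (al : aut Gam) (al' : aut Gam').
Context (be : giso Gam Gam') (h : Gam').
Context (hal : forall y : Gam', al' y = ad h (be (al (iso_inv be y)))).

Let sg (y : Gam') : Gam' := be (al (iso_inv be y)).

(* [twist k] is the Gam'-component of (h, 1)^k in the semidirect product of
   Gam' and Z acting by [be al be^-1]. *)
Definition twist (k : Z) : Gam' :=
  iterZ (fun y => h ** be (al (iso_inv be y)))
        (fun y => be (iso_inv al (iso_inv be (ginv h ** y)))) k gone.

Lemma sg_hom : is_hom _ _ sg.
Proof. by move=> x y; rewrite /sg iso_inv_hom !iso_hom. Qed.

Lemma sg_inj x y : sg x = sg y -> x = y.
Proof.
by move=> /giso_inj /giso_inj e; rewrite -(iso_funK be x) e iso_funK.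
Qed.

Lemma twist_succ k : twist (k + 1) = h ** sg (twist k).
Proof.
rewrite /twist (@iterZ_succ _ (fun y => h ** be (al (iso_inv be y)))) // => y.
by rewrite iso_invK iso_funK iso_funK gmulKVl.
Qed.

(** As [al'] is ad(h) after [sg], each further power pushes the conjugator through [sg] and
    multiplies it by [h], which is the recursion of [twist]. *)
Lemma aut_pow_twist k c : aut_pow al' k (be c) = ad (twist k) (be (aut_pow al k c)).
Proof.
move: k; apply: Z_ind2; first by rewrite ad1.
move=> k; rewrite !aut_pow_succ twist_succ adM.
have -> : be (al (aut_pow al k c)) = sg (be (aut_pow al k c)) by rewrite /sg iso_invK.
rewrite -(hom_ad _ _ sg_hom) hal -/(sg _).
by split=> [-> //|/ad_inj /sg_inj].
Qed.

Lemma twist_add k l : twist (k + l) = twist k ** be (aut_pow al k (iso_inv be (twist l))).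
Proof.
move: k; apply: Z_ind2; first by rewrite gmul1l iso_funK.
move=> k; have -> : (k + 1 + l = k + l + 1)%Z by lia.
rewrite aut_pow_succ !twist_succ -gmulA.
set t := aut_pow al k _.
have -> : be (al t) = sg (be t) by rewrite /sg iso_invK.
by rewrite -sg_hom; split=> [-> //|/gmulIl /sg_inj].
Qed.

Lemma G_isomorphic_of_conjugate : G_isomorphic al al'.
Proof.
(* The K'-component given to an element of V: it undoes the conjugation of [aut_pow_twist], and
   [twist_add] with the chain rule makes it a cocycle. *)
pose cc (f : cantor -> cantor) (x : Q2) := ginv (twist (- logslope f (qw (preim f x)))).
exists (fun g => (fun x => be (fst g x) ** cc (snd g) x, snd g)).
split; [|split; [|split]].
- by move=> [].
- move=> [a f] [b f'] _ _ /= [ha hf]; subst f'; congr pair; extensionality x.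
  by have := f_equal (fun k => k x) ha => /= /gmulIr /giso_inj.
- move=> [b f] hf; exists (fun x => iso_inv be (b x ** ginv (cc f x)), f); split=> //=.
  by congr pair; extensionality x; rewrite iso_funK gmulKVr.
- move=> [a f] [b f'] hf hf'; rewrite /Gmul /=; congr pair; extensionality x.
  set v := toV hf; set w := toV hf'.
  have hcc : forall v z, cc (vfun v) (av v z) = ginv (twist (- sl v z)).
    by move=> v' z; rewrite /cc preim_av.
  rewrite -(avKV v x); set y := av _ x; rewrite -(avKV w y); set z := av _ y.
  have -> : cc (fun y => f (f' y)) (av v (av w z)) = ginv (twist (- sl (vmul v w) z)).
    by rewrite -av_mul; apply: (hcc (vmul v w)).
  rewrite (hcc v) !(rho_av _ v) (hcc w) sl_mul iso_hom -!gmulA; congr gmul.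
  set k := sl v _; set l := sl w _; set d := b _.
  have -> : (- (k + l) = - k + - l)%Z by lia.
  rewrite twist_add -[be d ** _](iso_funK be) aut_pow_twist.
  rewrite iso_inv_hom iso_invK aut_pow_hom iso_hom.
  rewrite (homV _ (iso_inv_hom be)) (homV _ (aut_pow_hom al _)) (homV _ (iso_hom be)).
  by rewrite /ad ginvM !gmulA gmulVl gmul1l.
Qed.

End Converse.

Theorem mainTheorem1 (Gam Gam' : group) (al : aut Gam) (al' : aut Gam') :
  G_isomorphic al al' <->
  exists (be : giso Gam Gam') (h : Gam'),
    forall y : Gam', al' y = ad h (be (al (iso_inv be y))).
Proof.
split; first by move=> /giso_of_G_isomorphic [th]; apply: conjugate_of_giso th.
by move=> [be [h hal]]; apply: G_isomorphic_of_conjugate hal.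
Qed.
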